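(* Let $N\ge 1$ and $0\le K\le N$. For all paths $\alpha,\beta\in\mathcal{P}_{N,K}$, the parabolic Kazhdan--Lusztig polynomial $P^-_{\alpha,\beta}$ is given by $$P^-_{\alpha,\beta}(t^{-1})=Q^{II,-}_{\alpha,\beta}(t^{-1}),$$ and for $\alpha\in\mathcal{F}(\beta)$ this equals $t^{-d(\alpha,\beta)}$.
   Context: **Paths.** $\mathcal{P}_{N,K}$ is the set of lattice paths from $(0,0)$ to $(N,2K-N)$ with $N$ steps, each $(1,1)$ or $(1,-1)$. Write $\alpha(x)$ for the height of $\alpha$ at abscissa $x\in\{0,\dots,N\}$. Here (convention $\epsilon=-$) $\alpha\le\beta$ means that $\alpha$ is weakly below $\beta$: $\alpha(x)\le\beta(x)$ for all $x$. Paths are identified with binary strings $\alpha_1\cdots\alpha_N\in\{1,2\}^N$, where $\alpha_i=2$ if the $i$-th step is $(1,1)$ and $\alpha_i=1$ if it is $(1,-1)$. **Pairings, $\mathcal{F}(\beta)$, $d$.** The pairings of $\beta$ are the pairs $(i,j)$, $i<j$, with $\beta_i=2$, $\beta_j=1$, obtained by parenthesis matching with $2$ as opening and $1$ as closing parenthesis (some positions may be unpaired). Flipping a pairing $(i,j)$ means replacing $\beta_i=2,\beta_j=1$ by $1,2$ at positions $i,j$. $\mathcal{F}(\beta)$ is the set of all paths obtained from $\beta$ by flipping an arbitrary subset (possibly empty) of its pairings. $d(\alpha,\beta):=\#\{i:\alpha_i\ne\beta_i\}/2$. **Hecke algebra and the polynomials $P^-$.** Let $R=\mathbb{Z}[t,t^{-1}]$.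 The Hecke algebra $\mathcal{H}_N$ is the unital associative $R$-algebra with generators $T_1,\dots,T_{N-1}$ and relations $(T_i-t)(T_i+t^{-1})=0$, $T_iT_{i+1}T_i=T_{i+1}T_iT_{i+1}$, $T_iT_j=T_jT_i$ for $|i-j|>1$. The bar involution of $\mathcal{H}_N$ is the ring automorphism with $\overline{T_i}=T_i^{-1}$, $\overline t=t^{-1}$. Let $\mathcal{M}^-$ be the free $R$-module with basis $(m_\alpha)_{\alpha\in\mathcal{P}_{N,K}}$ and $\mathcal{H}_N$-action: if steps $i$ and $i+1$ of $\alpha$ are equal, $T_im_\alpha=-t^{-1}m_\alpha$; otherwise, with $\alpha'$ the path obtained by exchanging steps $i$ and $i+1$, $T_im_\alpha=m_{\alpha'}$ if $\alpha<\alpha'$ and $T_im_\alpha=(t-t^{-1})m_\alpha+m_{\alpha'}$ if $\alpha'<\alpha$. The bar involution on $\mathcal{M}^-$ is the unique additive map with $\overline{h m}=\overline h\,\overline m$ for $h\in\mathcal{H}_N$, $m\in\mathcal{M}^-$, and $\overline{m_{\beta_0}}=m_{\beta_0}$, where $\beta_0$ is the lowest path (string $1\cdots12\cdots2$). By Deodhar there is a unique basis $(C^-_\beta)_{\beta\in\mathcal{P}_{N,K}}$ of $\mathcal{M}^-$ with $\overline{C^-_\beta}=C^-_\beta$ and $C^-_\beta=\sum_{\alpha\le\beta}P^-_{\alpha,\beta}(t^{-1})m_\alpha$, where $P^-_{\beta,\beta}=1$ and $P^-_{\alpha,\beta}(t^{-1})\in t^{-1}\mathbb{Z}[t^{-1}]$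 for $\alpha<\beta$. Set $P^-_{\alpha,\beta}=0$ if $\alpha\not\le\beta$. **Dyck strips.** The box $(x,y)$ is the 45-degree rotated unit box with center $(x,y)$ and corners $(x\pm1,y),(x,y\pm1)$. The box $(x,y+2)$ (resp. $(x,y-2)$) is just above (resp. just below) $(x,y)$; $(x-1,y+1)$ and $(x+1,y+1)$ are NW and NE of $(x,y)$. A Dyck path of length $2l$, $l\ge0$, is a path with steps $(1,\pm1)$ from some $(x,y)\in\mathbb{Z}^2$ to $(x+2l,y)$ never going below height $y$. A Dyck strip of length $2l+1$ is the set of boxes centered at the vertices of a Dyck path of length $2l$. For $\alpha\le\beta$, the boxes between the two paths are the $(x,y)$ with $x+y$ odd, $0<x<N$, $\alpha(x)+1\le y\le\beta(x)-1$. A configuration is a partition of the set of boxes between $\alpha$ and $\beta$ into Dyck strips (no overlap, every box used). Rule II for an ordered pair $(D,D')$ of distinct Dyck strips: if there exists a box of $D'$ just above, NW or NE of a box of $D$, then all boxes just above, NW and NE of a box of $D$ (including any lying outside the region) belong to $D$ or $D'$. $\mathrm{Conf}^{II}(\alpha,\beta)$ is the set of configurations in which all ordered pairs of distinct strips satisfy Rule II. **Generating function.** For $\alpha<\beta$, $Q^{II,-}_{\alpha,\beta}(t^{-1})=\sum_{\mathcal{D}\in\mathrm{Conf}^{II}(\alpha,\beta)}t^{-|\mathcal{D}|}$, where $|\mathcal{D}|$ is the number of Dyck strips of $\mathcal{D}$; $Q^{II,-}_{\alpha,\alpha}=1$; $Q^{II,-}_{\alpha,\beta}=0$ if $\alpha\not\le\beta$.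 *)

(* Defs.v *)
From HB Require Import structures.
From mathcomp Require Import all_boot all_order perm all_algebra.
From mathcomp Require Import finmap boolp ring.

Set Implicit Arguments.
Unset Strict Implicit.
Unset Printing Implicit Defensive.

Import Order.TTheory GRing.Theory Num.Theory.
Local Open Scope ring_scope.
Local Open Scope quotient_scope.

Local Notation "x %:F" := (@FracField.tofrac _ x) : ring_scope.

(* The ring Z[t, t^-1] is realised inside Frac(Z[t]), as the set of p / t^n. *)
Definition is_laurent : {pred {fraction {poly int}}} :=
  fun x => `[< exists n p, x * ('X%:F) ^+ n = p%:F >].

Lemma is_laurentP x :
  reflect (exists n p, x * ('X%:F) ^+ n = p%:F) (x \in is_laurent).
Proof. exact: asboolP. Qed.

Lemma is_laurent_subring : subring_closed is_laurent.
Proof.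
split.
- by apply/is_laurentP; exists 0%N, 1; rewrite expr0 mulr1 rmorph1.
- move=> x y /is_laurentP[n [p xp]] /is_laurentP[m [q yq]]; apply/is_laurentP.
  exists (n + m)%N, (p * 'X^m - q * 'X^n).
  by rewrite rmorphB !rmorphM !rmorphXn /= -xp -yq exprD; ring.
- move=> x y /is_laurentP[n [p xp]] /is_laurentP[m [q yq]]; apply/is_laurentP.
  exists (n + m)%N, (p * q).
  by rewrite !rmorphM /= -xp -yq exprD; ring.
Qed.
HB.instance Definition _ :=
  GRing.isSubringClosed.Build _ is_laurent is_laurent_subring.

Record laurent := Laurent {
  laurent_val : {fraction {poly int}};
  laurent_valP : laurent_val \in is_laurent }.
HB.instance Definition _ := [isSub for laurent_val].
HB.instance Definition _ := [Choice of laurent by <:].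
HB.instance Definition _ := [SubChoice_isSubComNzRing of laurent by <:].

Lemma tfrac_neq0 : ('X : {poly int})%:F != 0.
Proof. by rewrite tofrac_eq0 polyX_eq0. Qed.

Lemma tfrac_laurent : ('X : {poly int})%:F \in is_laurent.
Proof. by apply/is_laurentP; exists 0%N, 'X; rewrite expr0 mulr1. Qed.

Lemma tfracV_laurent : (('X : {poly int})%:F)^-1 \in is_laurent.
Proof.
by apply/is_laurentP; exists 1%N, 1; rewrite expr1 mulVf ?tfrac_neq0 ?rmorph1.
Qed.

Definition tvar : laurent := Laurent tfrac_laurent.
Definition tinv : laurent := Laurent tfracV_laurent.

Lemma tvarK : tvar * tinv = 1.
Proof. by apply: val_inj; rewrite /= mulfV ?tfrac_neq0. Qed.

Lemma tinvKX n : tinv ^+ n * tvar ^+ n = 1.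
Proof. by rewrite -exprMn [tinv * _]mulrC tvarK expr1n. Qed.

(* With a = tinv this is the substitution p |-> p(t^-1). *)
Definition evalz (a : laurent) (p : {poly int}) : laurent :=
  (map_poly intr p).[a].

Lemma evalzB a p q : evalz a (p - q) = evalz a p - evalz a q.
Proof. by rewrite /evalz rmorphB hornerD hornerN. Qed.
Lemma evalzM a p q : evalz a (p * q) = evalz a p * evalz a q.
Proof. by rewrite /evalz rmorphM hornerM. Qed.
Lemma evalz1 a : evalz a 1 = 1.
Proof. by rewrite /evalz rmorph1 hornerC. Qed.
Lemma evalzXn a n : evalz a 'X^n = a ^+ n.
Proof. by rewrite /evalz map_polyXn hornerXn. Qed.

Lemma val_evalz p : val (evalz tvar p) = p%:F.
Proof.
elim/poly_ind: p => [|p c IHp].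
  by rewrite /evalz rmorph0 horner0 rmorph0.
rewrite /evalz rmorphD rmorphM /= map_polyX map_polyC hornerMXaddC.
rewrite [RHS]rmorphD rmorphM /= -IHp; congr (_ * _ + _).
by rewrite -[in RHS](intz c) !rmorph_int -(rmorph_int (\val : laurent -> _)).
Qed.

Lemma laurent_numerator (x : laurent) :
  exists np : nat * {poly int}, x * tvar ^+ np.1 == evalz tvar np.2.
Proof.
have /is_laurentP[n [p xp]] := laurent_valP x; exists (n, p).
by apply/eqP/val_inj; rewrite val_evalz rmorphM rmorphXn.
Qed.

(* The involution t |-> t^-1: write x * t^n = p(t) and return p(t^-1) * t^n. *)
Definition laurent_bar (x : laurent) : laurent :=
  let np := xchoose (laurent_numerator x) in evalz tinv np.2 * tvar ^+ np.1.

Lemma laurent_barE x n p :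
  x * tvar ^+ n = evalz tvar p -> laurent_bar x = evalz tinv p * tvar ^+ n.
Proof.
rewrite /laurent_bar.
case: (xchoose _) (xchooseP (laurent_numerator x)) => m q /= /eqP xq xp.
have pq : p * 'X^m = q * 'X^n.
  have inj a b : evalz tvar a = evalz tvar b -> a = b.
    by move=> /(congr1 val); rewrite !val_evalz => /eqP; rewrite tofrac_eq => /eqP.
  by apply: inj; rewrite !evalzM !evalzXn -xp -xq; ring.
have {}pq := congr1 (evalz tinv) pq; rewrite !evalzM !evalzXn in pq.
rewrite -[evalz tinv q]mulr1 -(tinvKX n) -[evalz tinv p]mulr1 -(tinvKX m).
by rewrite !mulrA -pq mulrAC.
Qed.

Lemma laurent_bar_is_additive : zmod_morphism laurent_bar.
Proof.
move=> x y; have [[n p] /= /eqP xp] := laurent_numerator x.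
have [[m q] /= /eqP yq] := laurent_numerator y.
rewrite (laurent_barE xp) (laurent_barE yq).
rewrite (@laurent_barE _ (n + m) (p * 'X^m - q * 'X^n)).
  rewrite evalzB !evalzM !evalzXn exprD.
  rewrite mulrBl mulrACA tinvKX mulr1; congr (_ - _).
  by rewrite [_ ^+ n * _]mulrC mulrACA tinvKX mulr1.
by rewrite evalzB !evalzM !evalzXn -xp -yq exprD; ring.
Qed.

Lemma laurent_bar_is_multiplicative : monoid_morphism laurent_bar.
Proof.
split.
  by rewrite (@laurent_barE _ 0 1) ?evalz1 ?expr0 ?mulr1.
move=> x y; have [[n p] /= /eqP xp] := laurent_numerator x.
have [[m q] /= /eqP yq] := laurent_numerator y.
rewrite (laurent_barE xp) (laurent_barE yq).
rewrite (@laurent_barE _ (n + m) (p * q)); first by rewrite evalzM exprD; ring.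
by rewrite evalzM -xp -yq exprD; ring.
Qed.
HB.instance Definition _ :=
  GRing.isZmodMorphism.Build laurent laurent laurent_bar laurent_bar_is_additive.
HB.instance Definition _ :=
  GRing.isMonoidMorphism.Build laurent laurent laurent_bar
    laurent_bar_is_multiplicative.

Lemma laurent_bar_t : laurent_bar tvar = tinv.
Proof.
have xp : tvar * tvar ^+ 0 = evalz tvar 'X^1 by rewrite evalzXn expr0 mulr1 expr1.
by rewrite (laurent_barE xp) evalzXn expr0 mulr1 expr1.
Qed.

Lemma laurent_bar_tinv : laurent_bar tinv = tvar.
Proof.
have xp : tinv * tvar ^+ 1 = evalz tvar 1 by rewrite evalz1 expr1 mulrC tvarK.
by rewrite (laurent_barE xp) evalz1 mul1r expr1.
Qed.

(* The Hecke algebra H_N is hecke N.-1: n is the number of generators, which   *)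
(* are indexed from 0. It is the quotient of the expressions in the generators *)
(* and the scalars by the congruence hecke_eq generated by the axioms of       *)
(* unital associative Z[t, t^-1]-algebras together with the Hecke relations.   *)
Inductive hexp (n : nat) : Type :=
| HGen of 'I_n
| HScal of laurent
| HAdd of hexp n & hexp n
| HMul of hexp n & hexp n.

Arguments HScal {n}.

Inductive hecke_eq (n : nat) : hexp n -> hexp n -> Prop :=
| heq_refl x : hecke_eq x x
| heq_sym x y : hecke_eq x y -> hecke_eq y x
| heq_trans x y z : hecke_eq x y -> hecke_eq y z -> hecke_eq x z
| heq_add x x' y y' :
    hecke_eq x x' -> hecke_eq y y' -> hecke_eq (HAdd x y) (HAdd x' y')
| heq_mul x x' y y' :
    hecke_eq x x' -> hecke_eq y y' -> hecke_eq (HMul x y) (HMul x' y')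
| heq_addA x y z : hecke_eq (HAdd x (HAdd y z)) (HAdd (HAdd x y) z)
| heq_addC x y : hecke_eq (HAdd x y) (HAdd y x)
| heq_add0 x : hecke_eq (HAdd (HScal 0) x) x
| heq_mulA x y z : hecke_eq (HMul x (HMul y z)) (HMul (HMul x y) z)
| heq_mulDl x y z :
    hecke_eq (HMul (HAdd x y) z) (HAdd (HMul x z) (HMul y z))
| heq_mulDr x y z :
    hecke_eq (HMul x (HAdd y z)) (HAdd (HMul x y) (HMul x z))
| heq_mul0 x : hecke_eq (HMul (HScal 0) x) (HScal 0)
| heq_mul1 x : hecke_eq (HMul (HScal 1) x) x
| heq_scalD a b : hecke_eq (HAdd (HScal a) (HScal b)) (HScal (a + b))
| heq_scalM a b : hecke_eq (HMul (HScal a) (HScal b)) (HScal (a * b))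
| heq_scalC a x : hecke_eq (HMul (HScal a) x) (HMul x (HScal a))
| heq_quad i :
    hecke_eq (HMul (HAdd (HGen i) (HScal (- tvar)))
                   (HAdd (HGen i) (HScal tinv)))
             (HScal 0)
| heq_braid (i j : 'I_n) : j = i.+1 :> nat ->
    hecke_eq (HMul (HGen i) (HMul (HGen j) (HGen i)))
             (HMul (HGen j) (HMul (HGen i) (HGen j)))
| heq_comm (i j : 'I_n) : (i.+1 < j)%N ->
    hecke_eq (HMul (HGen i) (HGen j)) (HMul (HGen j) (HGen i)).

#[local] Hint Constructors hecke_eq : core.

HB.instance Definition _ n := gen_eqMixin (hexp n).
HB.instance Definition _ n := gen_choiceMixin (hexp n).

Definition hecke_eqb n : rel (hexp n) := fun x y => `[< hecke_eq x y >].

Lemma hecke_eqb_equiv n : equiv_class_of (@hecke_eqb n).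
Proof.
split=> [x|x y|y x z]; rewrite /hecke_eqb.
- exact/asboolP.
- by apply/idP/idP => /asboolP xy; apply/asboolP; apply: heq_sym.
- by move=> /asboolP xy /asboolP yz; apply/asboolP; apply: heq_trans yz.
Qed.
Canonical hecke_equiv_rel n := EquivRelPack (hecke_eqb_equiv n).

Definition hecke n := {eq_quot (@hecke_eqb n)}.
HB.instance Definition _ n := Choice.on (hecke n).
HB.instance Definition _ n := EqQuotient.on (hecke n).

Definition hpi n (x : hexp n) : hecke n := \pi_(hecke n) x.

Lemma hpiP n (x y : hexp n) : hecke_eq x y <-> hpi x = hpi y.
Proof.
split=> [xy|/eqmodP/asboolP //]; by apply/eqmodP/asboolP.
Qed.

Lemma hrepr n (h : hecke n) : hpi (repr h) = h. Proof. exact: reprK. Qed.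

Lemma hrepr_eq n (x : hexp n) : hecke_eq (repr (hpi x)) x.
Proof. by apply/hpiP; rewrite hrepr. Qed.

Definition hecke_add n (x y : hecke n) := hpi (HAdd (repr x) (repr y)).
Definition hecke_mul n (x y : hecke n) := hpi (HMul (repr x) (repr y)).
Definition hecke_scal n (a : laurent) : hecke n := hpi (HScal a).
Definition hecke_opp n (x : hecke n) := hecke_mul (hecke_scal n (- 1)) x.

Lemma hpiD n (x y : hexp n) : hpi (HAdd x y) = hecke_add (hpi x) (hpi y).
Proof. by apply/hpiP/heq_add; apply/heq_sym/hrepr_eq. Qed.
Lemma hpiM n (x y : hexp n) : hpi (HMul x y) = hecke_mul (hpi x) (hpi y).
Proof. by apply/hpiP/heq_mul; apply/heq_sym/hrepr_eq. Qed.

Section HeckeRing.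
Variable n : nat.
Implicit Types x y z : hecke n.

Lemma hecke_addA : associative (@hecke_add n).
Proof.
move=> x y z; rewrite -(hrepr x) -(hrepr y) -(hrepr z) -!hpiD.
exact/hpiP/heq_addA.
Qed.
Lemma hecke_addC : commutative (@hecke_add n).
Proof. by move=> x y; rewrite -(hrepr x) -(hrepr y) -!hpiD; exact/hpiP. Qed.
Lemma hecke_add0 : left_id (hecke_scal n 0) (@hecke_add n).
Proof. by move=> x; rewrite -(hrepr x) -!hpiD; exact/hpiP. Qed.
Lemma hecke_addN : left_inverse (hecke_scal n 0) (@hecke_opp n) (@hecke_add n).
Proof.
move=> x; rewrite -(hrepr x) /hecke_opp -hpiM -!hpiD; apply/hpiP.
apply: heq_trans (heq_add (heq_refl _) (heq_sym (heq_mul1 _))) _.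
apply: heq_trans (heq_sym (heq_mulDl _ _ _)) _.
apply: heq_trans (heq_mul (heq_scalD _ _ _) (heq_refl _)) _.
by rewrite addNr.
Qed.
HB.instance Definition _ := GRing.isZmodule.Build (hecke n)
  hecke_addA hecke_addC hecke_add0 hecke_addN.

Lemma hecke_mulA : associative (@hecke_mul n).
Proof.
move=> x y z; rewrite -(hrepr x) -(hrepr y) -(hrepr z) -!hpiM.
exact/hpiP/heq_mulA.
Qed.
Lemma hecke_mul1l : left_id (hecke_scal n 1) (@hecke_mul n).
Proof. by move=> x; rewrite -(hrepr x) -hpiM; exact/hpiP. Qed.
Lemma hecke_mul1r : right_id (hecke_scal n 1) (@hecke_mul n).
Proof.
move=> x; rewrite -(hrepr x) -hpiM; apply/hpiP.
exact: heq_trans (heq_sym (heq_scalC _ _)) (heq_mul1 _).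
Qed.
Lemma hecke_mulDl : left_distributive (@hecke_mul n) (@hecke_add n).
Proof.
move=> x y z; rewrite -(hrepr x) -(hrepr y) -(hrepr z) -(hpiD (repr x)) -!hpiM -hpiD.
exact/hpiP/heq_mulDl.
Qed.
Lemma hecke_mulDr : right_distributive (@hecke_mul n) (@hecke_add n).
Proof.
move=> x y z; rewrite -(hrepr x) -(hrepr y) -(hrepr z) -(hpiD (repr y)) -!hpiM -hpiD.
exact/hpiP/heq_mulDr.
Qed.

(* The character T_i |-> t, used to see that the algebra is nonzero. *)
Fixpoint hexp_char (x : hexp n) : laurent :=
  match x with
  | HGen _ => tvar
  | HScal a => a
  | HAdd x y => hexp_char x + hexp_char y
  | HMul x y => hexp_char x * hexp_char y
  end.

Lemma hexp_char_eq (x y : hexp n) : hecke_eq x y -> hexp_char x = hexp_char y.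
Proof.
elim=> //= {x y}; try by move=> *; congruence.
- by move=> *; rewrite addrA.
- by move=> *; rewrite addrC.
- by move=> *; rewrite add0r.
- by move=> *; rewrite mulrA.
- by move=> *; rewrite mulrDl.
- by move=> *; rewrite mulrDr.
- by move=> *; rewrite mul0r.
- by move=> *; rewrite mul1r.
- by move=> *; rewrite mulrC.
- by move=> *; rewrite subrr mul0r.
Qed.

Lemma hecke_oner_neq0 : hecke_scal n 1 != 0.
Proof.
by apply/eqP => /hpiP/hexp_char_eq /= /eqP; rewrite oner_eq0.
Qed.
HB.instance Definition _ := GRing.Zmodule_isNzRing.Build (hecke n)
  hecke_mulA hecke_mul1l hecke_mul1r hecke_mulDl hecke_mulDr hecke_oner_neq0.

Lemma hpi_add (x y : hexp n) : hpi (HAdd x y) = hpi x + hpi y.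
Proof. exact: hpiD. Qed.
Lemma hpi_mul (x y : hexp n) : hpi (HMul x y) = hpi x * hpi y.
Proof. exact: hpiM. Qed.
Lemma hpi_scalD a b : hecke_scal n (a + b) = hecke_scal n a + hecke_scal n b.
Proof. by rewrite -hpi_add; exact/esym/hpiP. Qed.
Lemma hpi_scalM a b : hecke_scal n (a * b) = hecke_scal n a * hecke_scal n b.
Proof. by rewrite -hpi_mul; exact/esym/hpiP. Qed.
Lemma hpi_scalC a x : hecke_scal n a * x = x * hecke_scal n a.
Proof. by rewrite -(hrepr x) -!hpi_mul; exact/hpiP. Qed.

Definition hecke_scale (a : laurent) x : hecke n := hecke_scal n a * x.

Lemma hecke_scaleA a b x : hecke_scale a (hecke_scale b x) = hecke_scale (a * b) x.
Proof. by rewrite /hecke_scale hpi_scalM mulrA. Qed.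
Lemma hecke_scale1 : left_id 1 hecke_scale.
Proof. by move=> x; rewrite /hecke_scale mul1r. Qed.
Lemma hecke_scaleDr : right_distributive hecke_scale +%R.
Proof. by move=> a x y; rewrite /hecke_scale mulrDr. Qed.
Lemma hecke_scaleDl x : {morph hecke_scale^~ x : a b / a + b}.
Proof. by move=> a b; rewrite /hecke_scale hpi_scalD mulrDl. Qed.
HB.instance Definition _ := GRing.Zmodule_isLmodule.Build laurent (hecke n)
  hecke_scaleA hecke_scale1 hecke_scaleDr hecke_scaleDl.

Lemma hecke_scaleAl (a : laurent) x y : a *: (x * y) = (a *: x) * y.
Proof. exact: mulrA. Qed.
HB.instance Definition _ :=
  GRing.Lmodule_isLalgebra.Build laurent (hecke n) hecke_scaleAl.
Lemma hecke_scaleAr (a : laurent) x y : a *: (x * y) = x * (a *: y).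
Proof.
rewrite -[LHS]/(hecke_scal n a * (x * y)) -[a *: y]/(hecke_scal n a * y).
by rewrite !mulrA hpi_scalC.
Qed.
HB.instance Definition _ :=
  GRing.Lalgebra_isAlgebra.Build laurent (hecke n) hecke_scaleAr.

Definition hgen (i : 'I_n) : hecke n := hpi (HGen i).

Lemma hecke_scalE a : hecke_scal n a = a%:A.
Proof. by rewrite -[RHS]/(hecke_scal n a * 1) mulr1. Qed.

Lemma hgen_quad i : (hgen i - tvar%:A) * (hgen i + tinv%:A) = 0.
Proof.
have /hpiP := heq_quad i; rewrite hpi_mul !hpi_add.
by rewrite -![hpi (HScal _)]/(hecke_scal n _) !hecke_scalE scaleNr scale0r.
Qed.

Lemma hgen_braid (i j : 'I_n) : j = i.+1 :> nat ->
  hgen i * hgen j * hgen i = hgen j * hgen i * hgen j.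
Proof. by move=> /heq_braid/hpiP; rewrite !hpi_mul !mulrA. Qed.

Lemma hgen_comm (i j : 'I_n) : (i.+1 < j)%N -> hgen i * hgen j = hgen j * hgen i.
Proof. by move=> /heq_comm/hpiP; rewrite !hpi_mul. Qed.

Definition hgenV (i : 'I_n) : hecke n := hgen i - (tvar - tinv)%:A.

Lemma hgenK i : hgen i * hgenV i = 1.
Proof.
have Q : hgen i * hgen i + tinv *: hgen i - tvar *: hgen i = 1.
  apply/eqP; rewrite -subr_eq0 -[X in _ == X](hgen_quad i); apply/eqP.
  rewrite mulrBl !mulrDr mulr_algr !mulr_algl scalerA tvarK scale1r.
  by rewrite opprD addrA.
rewrite -[RHS]Q /hgenV scalerBl mulrDr mulrN mulrBr !mulr_algr opprB.
by rewrite addrCA addrA [_ + hgen i * _]addrC.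
Qed.

Lemma hgenVK i : hgenV i * hgen i = 1.
Proof. by rewrite -(hgenK i) /hgenV mulrBl mulrBr mulr_algl mulr_algr. Qed.

(* T_i - (t - t^-1) is the inverse of T_i, by the quadratic relation. *)
Fixpoint hexp_bar (x : hexp n) : hecke n :=
  match x with
  | HGen i => hgenV i
  | HScal a => (laurent_bar a)%:A
  | HAdd x y => hexp_bar x + hexp_bar y
  | HMul x y => hexp_bar x * hexp_bar y
  end.

Lemma hexp_bar_eq (x y : hexp n) : hecke_eq x y -> hexp_bar x = hexp_bar y.
Proof.
elim=> //= {x y}; try by move=> *; congruence.
- by move=> *; rewrite addrA.
- by move=> *; rewrite addrC.
- by move=> *; rewrite rmorph0 scale0r add0r.
- by move=> *; rewrite mulrA.
- by move=> *; rewrite mulrDl.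
- by move=> *; rewrite mulrDr.
- by move=> *; rewrite rmorph0 scale0r mul0r.
- by move=> *; rewrite rmorph1 scale1r mul1r.
- by move=> *; rewrite rmorphD scalerDl.
- by move=> *; rewrite rmorphM mulr_algl scalerA.
- by move=> *; rewrite mulr_algl mulr_algr.
- move=> i; rewrite rmorphN /= laurent_bar_t laurent_bar_tinv rmorph0 scale0r.
  have -> : hgenV i + (- tinv)%:A = hgen i - tvar%:A.
    by rewrite /hgenV scalerBl scaleNr opprB addrA addrAC addrK.
  have -> : hgenV i + tvar%:A = hgen i + tinv%:A.
    by rewrite /hgenV scalerBl opprB -!addrA addNr addr0.
  exact: hgen_quad.
- move=> i j /hgen_braid ij.
  set u := hgenV i; set v := hgenV j.
  have E : u * v * u * (hgen i * hgen j * hgen i) = 1.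
    by rewrite -!mulrA [u * (hgen i * _)]mulrA hgenVK mul1r
               [v * (hgen j * _)]mulrA hgenVK mul1r hgenVK.
  have F : hgen j * hgen i * hgen j * (v * u * v) = 1.
    by rewrite -!mulrA [hgen j * (v * _)]mulrA hgenK mul1r
               [hgen i * (u * _)]mulrA hgenK mul1r hgenK.
  rewrite !mulrA -[LHS]mulr1 -F -ij mulrA E mul1r //.
- move=> i j /hgen_comm ij.
  have E : hgenV i * hgenV j * (hgen j * hgen i) = 1.
    by rewrite -!mulrA [hgenV j * (_ * _)]mulrA hgenVK mul1r hgenVK.
  have F : hgen i * hgen j * (hgenV j * hgenV i) = 1.
    by rewrite -!mulrA [hgen j * (_ * _)]mulrA hgenK mul1r hgenK.
  by rewrite -[LHS]mulr1 -F ij mulrA E mul1r.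
Qed.

Definition hecke_bar (h : hecke n) : hecke n := hexp_bar (repr h).

Lemma hecke_barE (x : hexp n) : hecke_bar (hpi x) = hexp_bar x.
Proof. exact/hexp_bar_eq/hrepr_eq. Qed.

Lemma hecke_bar_gen i : hecke_bar (hgen i) = hgenV i.
Proof. exact: (hecke_barE (HGen i)). Qed.

Lemma hecke_bar_scal a : hecke_bar a%:A = (laurent_bar a)%:A.
Proof. by rewrite -[a%:A]hecke_scalE; exact: (hecke_barE (HScal a)). Qed.

Lemma hecke_bar_is_monoid_morphism : monoid_morphism hecke_bar.
Proof.
split; first by rewrite -[1]scale1r hecke_bar_scal rmorph1.
by move=> x y; rewrite -(hrepr x) -(hrepr y) -hpi_mul !hecke_barE.
Qed.

Lemma hecke_bar_is_zmod_morphism : zmod_morphism hecke_bar.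
Proof.
move=> x y; rewrite -scaleN1r -mulr_algl -hecke_scalE -[x]hrepr -[y]hrepr.
rewrite -hpi_mul -hpi_add !hecke_barE /= rmorphN1 scaleN1r.
by rewrite mulNr mul1r.
Qed.
HB.instance Definition _ := GRing.isZmodMorphism.Build (hecke n) (hecke n)
  hecke_bar hecke_bar_is_zmod_morphism.
HB.instance Definition _ := GRing.isMonoidMorphism.Build (hecke n) (hecke n)
  hecke_bar hecke_bar_is_monoid_morphism.

End HeckeRing.

(* true is an up step (the letter 2), false a down step (the letter 1).        *)
Definition step_sign (b : bool) : int := if b then 1 else -1.

Definition height (w : seq bool) (x : nat) : int :=
  \sum_(b <- take x w) step_sign b.

Definition lpath_pred (N K : nat) (w : N.-tuple bool) : bool :=
  height w N == (2 * K)%N%:Z - N%:Z.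

Record lpath (N K : nat) := LPath {
  word :> N.-tuple bool;
  wordP : lpath_pred K word }.
HB.instance Definition _ N K := [isSub for @word N K].
HB.instance Definition _ N K := [Finite of lpath N K by <:].

Definition path_le N K (a b : lpath N K) : bool :=
  [forall x : 'I_N.+1, height a x <= height b x].
Definition path_lt N K (a b : lpath N K) : bool := (a != b) && path_le a b.

Section Exchange.
Variable N : nat.
Implicit Types i : 'I_N.-1.

Lemma lo_subproof i : (i < N)%N.
Proof. exact: leq_trans (ltn_ord i) (leq_pred N). Qed.
Lemma hi_subproof i : (i.+1 < N)%N.
Proof. by rewrite -ltn_predRL. Qed.
Definition lo i : 'I_N := Ordinal (lo_subproof i).
Definition hi i : 'I_N := Ordinal (hi_subproof i).

Definition exchange_word i (w : N.-tuple bool) : N.-tuple bool :=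
  [tuple tnth w (tperm (lo i) (hi i) j) | j < N].

Lemma heightE (w : N.-tuple bool) x : (x <= N)%N ->
  height w x = \sum_(j < N | (j < x)%N) step_sign (tnth w j).
Proof.
move=> xN; rewrite /height (big_nth false) size_take size_tuple.
have -> : (if (x < N)%N then x else N) = x.
  by case: ltngtP xN => // ->.
rewrite big_mkord (eq_bigr (fun j : 'I_x => step_sign (nth false w j))).
  rewrite (big_ord_widen N (fun j => step_sign (nth false w j))) //.
  by apply: eq_bigr => j _; rewrite (tnth_nth false).
by move=> j _; rewrite nth_take.
Qed.

Lemma lo_hi i : (lo i == hi i) = false.
Proof. by apply/eqP => /(congr1 val) /= /eqP; rewrite ltn_eqF. Qed.

Lemma height_exchange i (w : N.-tuple bool) x : (x <= N)%N ->
  height (exchange_word i w) x = height w x +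
    (if x == i.+1 then step_sign (tnth w (hi i)) - step_sign (tnth w (lo i))
     else 0).
Proof.
move=> xN; rewrite !heightE //.
under eq_bigr => j _ do rewrite tnth_mktuple.
case: (ltngtP x i.+1) => [xi|xi|xi]; rewrite ?addr0.
- apply: eq_bigr => j jx; have ji := leq_trans jx xi.
  by rewrite tpermD // -val_eqE /= gtn_eqF // ltnW.
- rewrite [RHS](reindex_inj (@perm_inj _ (tperm (lo i) (hi i)))) /=.
  apply: eq_bigl => j; case: tpermP => [->|->|] //=.
    by rewrite xi ltnW.
  by rewrite xi ltnW.
- subst x; rewrite (bigD1 (lo i)) //= [in RHS](bigD1 (lo i)) //= tpermL.
  rewrite (eq_bigr (fun j => step_sign (tnth w j))); first by ring.
  move=> j /andP[ji jlo]; rewrite tpermD // 1?eq_sym //.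
  by rewrite -val_eqE /= ltn_eqF.
Qed.

Lemma exchange_wordP i K (w : N.-tuple bool) :
  lpath_pred K w -> lpath_pred K (exchange_word i w).
Proof.
rewrite /lpath_pred height_exchange // ifN ?addr0 //.
by rewrite neq_ltn hi_subproof orbT.
Qed.

Variable K : nat.
Implicit Types a : lpath N K.

Definition exchange i a : lpath N K := LPath (exchange_wordP i (wordP a)).

Lemma tnth_exchange i a j :
  tnth (exchange i a) j = tnth a (tperm (lo i) (hi i) j).
Proof. by rewrite tnth_mktuple. Qed.

Lemma lpathP a a' : tnth a =1 tnth a' -> a = a'.
Proof. by move=> E; apply/val_inj/eq_from_tnth. Qed.

Lemma exchange_lt i a : tnth a (lo i) != tnth a (hi i) ->
  path_lt a (exchange i a) = ~~ tnth a (lo i).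
Proof.
move=> ne; rewrite /path_lt.
have -> : a != exchange i a.
  apply: contraNneq ne => E; apply/eqP.
  by rewrite [in LHS]E tnth_exchange tpermL.
apply/forallP/idP => [/(_ (lift ord0 (lo i)))|lo0 x].
  have -> : lift ord0 (lo i) = i.+1 :> nat by [].
  rewrite height_exchange ?(ltn_ord (lo i)) // eqxx lerDl.
  by case: (tnth _ _) (tnth _ _) ne => [] [].
rewrite height_exchange -1?ltnS ?ltn_ord // lerDl.
by case: ifP => // _; case: (tnth _ _) (tnth _ _) ne lo0 => [] [].
Qed.

End Exchange.

Definition pmod (R : comNzRingType) (N K : nat) := {ffun lpath N K -> R^o}.
HB.instance Definition _ R N K := GRing.Lmodule.on (pmod R N K).

Lemma scalar_quad (R : comNzRingType) (t v : R) : t * v = 1 ->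
  (- v) * (- v) = (t - v) * - v + 1.
Proof.
move=> tv; have E : (t - v) * - v = v * v - t * v by ring.
by rewrite E tv; ring.
Qed.

Lemma scalar_three (R : comNzRingType) (t v : R) : t * v = 1 ->
  - v * (t - v) * (t - v) + (t - v) = - v * - v * (t - v).
Proof.
move=> tv; have E : - v * (t - v) = v * v - t * v by ring.
by rewrite E tv; ring.
Qed.

Lemma three_0 (R : comNzRingType) (V : lmodType R) (T1 T2 : {linear V -> V})
    (u : V) (d : R) :
  T1 u = d *: u -> T2 u = d *: u -> T1 (T2 (T1 u)) = T2 (T1 (T2 u)).
Proof. by move=> T1u T2u; rewrite T1u T2u !linearZ /= T1u T2u !linearZ /= T1u T2u. Qed.

Section ThreeVectors.
Variables (R : comNzRingType) (V : lmodType R) (T1 T2 : {linear V -> V}).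
Variables (u v w : V) (c d : R).
Hypotheses (T1u : T1 u = d *: u) (T2u : T2 u = v) (T1v : T1 v = w).
Hypotheses (T2v : T2 v = c *: v + u).
Hypotheses (T1w : T1 w = c *: w + v) (T2w : T2 w = d *: w).
Hypothesis cd : d * c * c + c = d * d * c.

Lemma three_u : T1 (T2 (T1 u)) = T2 (T1 (T2 u)).
Proof. by rewrite T1u !linearZ /= T2u T1v T2w. Qed.

Lemma three_v : T1 (T2 (T1 v)) = T2 (T1 (T2 v)).
Proof.
rewrite T1v T2v [T1 (_ + _)]linearD linearZ /= T1v T1u T2w.
rewrite [T2 (_ + _)]linearD !linearZ /= T2w T2u T1w.
by rewrite scalerDr !scalerA [c * d]mulrC.
Qed.

Lemma three_w : T1 (T2 (T1 w)) = T2 (T1 (T2 w)).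
Proof.
rewrite T1w T2w [T2 (_ + _)]linearD linearZ /= T2w T2v.
rewrite [T1 (_ + _)]linearD [T1 (_ + u)]linearD !linearZ /= T1v T1u T1w.
rewrite [T2 (_ *: _ + _)]linearD !linearZ /= T2v T2w.
rewrite !scalerDr !scalerA [d * c * d]mulrAC -cd scalerDl -!addrA.
by congr (_ + _); rewrite addrCA.
Qed.
End ThreeVectors.

Section ParabolicModule.
Variables (R : comNzRingType) (t v : R) (N K : nat).
Local Notation M := (pmod R N K).
Implicit Types (i j : 'I_N.-1) (a : lpath N K).

Definition mvec a : M := [ffun b => (b == a)%:R].

Lemma pmod_expand (x : M) : x = \sum_a x a *: mvec a.
Proof.
apply/ffunP => b; rewrite sum_ffunE (bigD1 b) //= big1 ?addr0.
  by rewrite !ffunE eqxx [RHS]mulr1.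
by move=> a ab; rewrite !ffunE eq_sym (negPf ab) [LHS]mulr0.
Qed.

(* The action of T_i on the basis; t and v = t^-1 are kept as parameters.      *)
Definition gen_on_basis i a : M :=
  if tnth a (lo i) == tnth a (hi i) then (- v) *: mvec a
  else let a' := exchange i a in
    if path_lt a a' then mvec a' else (t - v) *: mvec a + mvec a'.

Definition gen_act i (x : M) : M := \sum_a x a *: gen_on_basis i a.

Lemma gen_act_is_linear i : linear (gen_act i).
Proof.
move=> c x y; rewrite /gen_act scaler_sumr -big_split /=.
by apply: eq_bigr => a _; rewrite !ffunE scalerDl scalerA.
Qed.
HB.instance Definition _ i := GRing.isLinear.Build R M M *:%R
  (gen_act i) (gen_act_is_linear i).

Lemma gen_act_mvec i a : gen_act i (mvec a) = gen_on_basis i a.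
Proof.
rewrite /gen_act (bigD1 a) //= big1 ?addr0.
  by rewrite ffunE eqxx scale1r.
by move=> b ba; rewrite ffunE (negPf ba) scale0r.
Qed.

Lemma pmod_ind (P : M -> Prop) :
  P 0 -> (forall c x y, P x -> P y -> P (c *: x + y)) ->
  (forall a, P (mvec a)) -> forall x, P x.
Proof.
move=> P0 PD Pm x; rewrite (pmod_expand x).
by elim/big_rec: _ => // a y _ Py; apply: PD.
Qed.

Definition coefA (x y : bool) : R :=
  if x == y then - v else if x then t - v else 0.
Definition coefB (x y : bool) : R := (x != y)%:R.

Lemma gen_actE i a : gen_act i (mvec a) =
  coefA (tnth a (lo i)) (tnth a (hi i)) *: mvec a +
  coefB (tnth a (lo i)) (tnth a (hi i)) *: mvec (exchange i a).
Proof.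
rewrite gen_act_mvec /gen_on_basis /coefA /coefB.
case: eqVneq => [_|ne]; first by rewrite scale0r addr0.
rewrite (exchange_lt ne) scale1r.
by case: (tnth a (lo i)) => /=; rewrite ?scale0r ?add0r.
Qed.

Lemma exchangeK i a : exchange i (exchange i a) = a.
Proof. by apply: lpathP => k; rewrite !tnth_exchange tpermK. Qed.

Lemma exchange_id i a : tnth a (lo i) = tnth a (hi i) -> exchange i a = a.
Proof.
by move=> E; apply: lpathP => k; rewrite tnth_exchange; case: tpermP => [->|->|].
Qed.

Hypothesis tv : t * v = 1.

Lemma gen_act_quad i x :
  gen_act i (gen_act i x) = (t - v) *: gen_act i x + x.
Proof.
elim/pmod_ind: x => [|c x y hx hy|a]; first by rewrite !linear0 addr0.
  rewrite !linearP /= hx hy !scalerDr !scalerA [c * _]mulrC.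
  by rewrite -!addrA; congr (_ + _); rewrite addrCA.
have [E|ne] := eqVneq (tnth a (lo i)) (tnth a (hi i)).
  rewrite gen_actE /coefA /coefB E eqxx /= scale0r addr0 linearZ /=.
  rewrite gen_actE /coefA /coefB E eqxx /= scale0r addr0 !scalerA.
  by rewrite -[X in _ + X]scale1r -scalerDl (scalar_quad tv).
rewrite [gen_act i (mvec a)]gen_actE linearD !linearZ /= !gen_actE.
rewrite !tnth_exchange tpermL tpermR exchangeK /coefA /coefB.
rewrite [_ == tnth a (lo i)]eq_sym (negPf ne).
case: (tnth a (lo i)) ne; case: (tnth a (hi i)) => //= _;
  rewrite !(scale1r, scale0r, add0r, addr0, scaler0, scalerDr, addrA) //.
Qed.


Lemma gen_act_braid i j x : j = i.+1 :> nat ->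
  gen_act i (gen_act j (gen_act i x)) = gen_act j (gen_act i (gen_act j x)).
Proof.
move=> ij; have loj : lo j = hi i by apply/val_inj.
have [n1 n2 n3] : [/\ lo i != hi j, lo i != hi i & hi i != hi j].
  by rewrite -!val_eqE /= ij; split; rewrite ltn_eqF.
elim/pmod_ind: x => [|c x y hx hy|a]; first by rewrite !linear0.
  by rewrite !linearP /= hx hy.
have tD : tperm (lo i) (hi i) (hi j) = hi j by rewrite tpermD.
have tD' : tperm (hi i) (hi j) (lo i) = lo i by rewrite tpermD // eq_sym.
have eT := (tpermL, tpermR, tD, tD').
have Ei (b : lpath N K) : gen_act i (mvec b) = _ := gen_actE i b.
have Ej (b : lpath N K) : gen_act j (mvec b) =
    coefA (tnth b (hi i)) (tnth b (hi j)) *: mvec b +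
    coefB (tnth b (hi i)) (tnth b (hi j)) *: mvec (exchange j b).
  by rewrite gen_actE loj.
have Xi (b : lpath N K) k : tnth (exchange i b) k = tnth b (tperm (lo i) (hi i) k).
  exact: tnth_exchange.
have Xj (b : lpath N K) k : tnth (exchange j b) k = tnth b (tperm (hi i) (hi j) k).
  by rewrite -loj; exact: tnth_exchange.
have K1 (b : lpath N K) : tnth b (lo i) = false -> tnth b (hi i) = false ->
    tnth b (hi j) = true ->
    let y := exchange j b in let w := exchange i y in
    [/\ gen_act i (mvec b) = (- v) *: mvec b, gen_act j (mvec b) = mvec y,
        gen_act i (mvec y) = mvec w,
        gen_act j (mvec y) = (t - v) *: mvec y + mvec b &
        gen_act i (mvec w) = (t - v) *: mvec w + mvec y /\
        gen_act j (mvec w) = (- v) *: mvec w].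
  move=> b1 b2 b3 y w; rewrite /w /y !Ei !Ej !(Xi, Xj, eT) b1 b2 b3.
  rewrite !exchangeK /coefA /coefB /= !(scale0r, scale1r, add0r, addr0).
  by split.
have K2 (b : lpath N K) : tnth b (lo i) = false -> tnth b (hi i) = true ->
    tnth b (hi j) = true ->
    let y := exchange i b in let w := exchange j y in
    [/\ gen_act j (mvec b) = (- v) *: mvec b, gen_act i (mvec b) = mvec y,
        gen_act j (mvec y) = mvec w,
        gen_act i (mvec y) = (t - v) *: mvec y + mvec b &
        gen_act j (mvec w) = (t - v) *: mvec w + mvec y /\
        gen_act i (mvec w) = (- v) *: mvec w].
  move=> b1 b2 b3 y w; rewrite /w /y !Ei !Ej !(Xi, Xj, eT) b1 b2 b3.
  rewrite !exchangeK /coefA /coefB /= !(scale0r, scale1r, add0r, addr0).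
  by split.
have cd := scalar_three tv.
pose br b := gen_act i (gen_act j (gen_act i (mvec b))) =
  gen_act j (gen_act i (gen_act j (mvec b))).
have B1 (b : lpath N K) (b1 : tnth b (lo i) = false) (b2 : tnth b (hi i) = false)
    (b3 : tnth b (hi j) = true) :
    [/\ br b, br (exchange j b) & br (exchange i (exchange j b))].
  have [h1 h2 h3 h4 [h5 h6]] := K1 b b1 b2 b3; split.
  - exact: (three_u h1 h2 h3 h6).
  - exact: (three_v h1 h2 h3 h4 h5 h6).
  - exact: (three_w h1 h3 h4 h5 h6 cd).
have B2 (b : lpath N K) (b1 : tnth b (lo i) = false) (b2 : tnth b (hi i) = true)
    (b3 : tnth b (hi j) = true) :
    [/\ br b, br (exchange i b) & br (exchange j (exchange i b))].
  have [h1 h2 h3 h4 [h5 h6]] := K2 b b1 b2 b3; split; apply: esym.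
  - exact: (three_u h1 h2 h3 h6).
  - exact: (three_v h1 h2 h3 h4 h5 h6).
  - exact: (three_w h1 h3 h4 h5 h6 cd).
have B0 (b : lpath N K) : tnth b (lo i) = tnth b (hi i) -> tnth b (hi i) = tnth b (hi j) ->
    br b.
  move=> e1 e2.
  have h1 : gen_act i (mvec b) = (- v) *: mvec b.
    by rewrite Ei e1 /coefA /coefB eqxx scale0r addr0.
  have h2 : gen_act j (mvec b) = (- v) *: mvec b.
    by rewrite Ej e2 /coefA /coefB eqxx scale0r addr0.
  exact: (three_0 h1 h2).
rewrite -/(br a).
case a1: (tnth a (lo i)); case a2: (tnth a (hi i)); case a3: (tnth a (hi j));
  try by apply: B0; rewrite ?a1 ?a2 ?a3.
- have [||| _ _] := B2 (exchange i (exchange j a));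
    by rewrite ?exchangeK ?(Xi, Xj, eT, a1, a2, a3).
- have [||| _ +  _] := B2 (exchange i a);
    by rewrite ?exchangeK ?(Xi, Xj, eT, a1, a2, a3).
- have [||| _ _] := B1 (exchange j (exchange i a));
    by rewrite ?exchangeK ?(Xi, Xj, eT, a1, a2, a3).
- by have [||| +  _ _] := B2 a.
- have [||| _ +  _] := B1 (exchange j a);
    by rewrite ?exchangeK ?(Xi, Xj, eT, a1, a2, a3).
- by have [||| +  _ _] := B1 a.
Qed.

Lemma gen_act_comm i j x : (i.+1 < j)%N ->
  gen_act i (gen_act j x) = gen_act j (gen_act i x).
Proof.
move=> ij.
have [n1 n2 n3 n4] :
    [/\ lo i != lo j, lo i != hi j, hi i != lo j & hi i != hi j].
  rewrite -!val_eqE /=; split; rewrite ltn_eqF //.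
  - exact: ltnW.
  - exact/ltnW/ltnW.
  - exact/leqW.
elim/pmod_ind: x => [|c x y hx hy|a]; first by rewrite !linear0.
  by rewrite !linearP /= hx hy.
have Dj1 : tperm (lo j) (hi j) (lo i) = lo i by rewrite tpermD // eq_sym.
have Dj2 : tperm (lo j) (hi j) (hi i) = hi i by rewrite tpermD // eq_sym.
have Di1 : tperm (lo i) (hi i) (lo j) = lo j by rewrite tpermD.
have Di2 : tperm (lo i) (hi i) (hi j) = hi j by rewrite tpermD.
have eT := (tpermL, tpermR, Dj1, Dj2, Di1, Di2).
have XX : exchange i (exchange j a) = exchange j (exchange i a).
  apply: lpathP => k; rewrite !tnth_exchange; congr (tnth a _).
  have [<-|k1] := eqVneq (lo i) k; first by rewrite !eT.
  have [<-|k2] := eqVneq (hi i) k; first by rewrite !eT.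
  have [<-|k3] := eqVneq (lo j) k; first by rewrite !eT.
  have [<-|k4] := eqVneq (hi j) k; first by rewrite !eT.
  by rewrite (tpermD k1 k2) (tpermD k3 k4) (tpermD k1 k2).
rewrite [gen_act i (mvec a)]gen_actE [gen_act j (mvec a)]gen_actE.
rewrite !linearD !linearZ /= !gen_actE !tnth_exchange !eT XX.
set p := coefA _ _; set q := coefB _ _; set r := coefA _ _; set s := coefB _ _.
rewrite !scalerDr !scalerA ![r * _]mulrC ![q * _]mulrC.
by rewrite -!addrA; congr (_ + _); rewrite addrCA.
Qed.
End ParabolicModule.

Local Notation M N K := (pmod laurent N K).

Section HeckeAction.
Variables N K : nat.
Implicit Types (x y : M N K).

Fixpoint hexp_act (h : hexp N.-1) x : M N K :=
  match h with
  | HGen i => gen_act tvar tinv i x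
  | HScal a => a *: x
  | HAdd g h => hexp_act g x + hexp_act h x
  | HMul g h => hexp_act g (hexp_act h x)
  end.

Lemma hexp_actP h c x y :
  hexp_act h (c *: x + y) = c *: hexp_act h x + hexp_act h y.
Proof.
elim: h x y => [i|a|g IHg h IHh|g IHg h IHh] x y /=.
- exact: gen_act_is_linear.
- by rewrite scalerDr !scalerA [a * c]mulrC.
- by rewrite IHg IHh scalerDr addrACA.
- by rewrite IHh IHg.
Qed.

Lemma hexp_actD h x y : hexp_act h (x + y) = hexp_act h x + hexp_act h y.
Proof. by have := hexp_actP h 1 x y; rewrite !scale1r. Qed.

Lemma hexp_act0 h : hexp_act h 0 = 0.
Proof. by apply: (addrI (hexp_act h 0)); rewrite -hexp_actD !addr0. Qed.

Lemma hexp_actZ h c x : hexp_act h (c *: x) = c *: hexp_act h x.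
Proof. by have := hexp_actP h c x 0; rewrite hexp_act0 !addr0. Qed.

Lemma hexp_act_eq g h : hecke_eq g h -> hexp_act g =1 hexp_act h.
Proof.
elim=> {g h} //=.
- by move=> g h _ E x; rewrite E.
- by move=> g h g' _ E _ E' x; rewrite E.
- by move=> g g' h h' _ E _ E' x; rewrite E E'.
- by move=> g g' h h' _ E _ E' x; rewrite E E'.
- by move=> f g h x; rewrite addrA.
- by move=> g h x; rewrite addrC.
- by move=> h x; rewrite scale0r add0r.
- by move=> f g h x; rewrite hexp_actD.
- by move=> h x; rewrite !scale0r.
- by move=> h x; rewrite scale1r.
- by move=> a b x; rewrite scalerDl.
- by move=> a b x; rewrite scalerA.
- by move=> a h x; rewrite hexp_actZ.
- move=> i x; rewrite scale0r scaleNr.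
  have E := hexp_actD (HGen i) (gen_act tvar tinv i x) (tinv *: x).
  rewrite /= in E; rewrite E {E}.
  have E := hexp_actZ (HGen i) tinv x; rewrite /= in E; rewrite E {E}.
  rewrite (gen_act_quad tvarK) scalerDr scalerA tvarK scale1r scalerBl.
  have Z (A B C : M N K) : A - B + C + B - (A + C) = 0.
    by rewrite [A - B + C]addrAC subrK subrr.
  exact: Z.
- by move=> i j ij x; exact: (gen_act_braid tvarK _ ij).
- by move=> i j ij x; exact: gen_act_comm.
Qed.

Definition hecke_act (h : hecke N.-1) x : M N K := hexp_act (repr h) x.

Lemma hecke_act_hpi h x : hecke_act (hpi h) x = hexp_act h x.
Proof. exact/hexp_act_eq/hrepr_eq. Qed.

Lemma hecke_act_gen i x : hecke_act (hgen i) x = gen_act tvar tinv i x.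
Proof. exact: (hecke_act_hpi (HGen i)). Qed.

Lemma hecke_actA g h x : hecke_act (g * h) x = hecke_act g (hecke_act h x).
Proof. by rewrite -(hrepr g) -(hrepr h) -hpi_mul !hecke_act_hpi. Qed.

Lemma hecke_actDl g h x : hecke_act (g + h) x = hecke_act g x + hecke_act h x.
Proof. by rewrite -(hrepr g) -(hrepr h) -hpi_add !hecke_act_hpi. Qed.

Lemma hecke_actDr h x y : hecke_act h (x + y) = hecke_act h x + hecke_act h y.
Proof. exact: hexp_actD. Qed.

Lemma hecke_act_scal a x : hecke_act a%:A x = a *: x.
Proof. by rewrite -[a%:A]hecke_scalE; exact: (hecke_act_hpi (HScal a)). Qed.

Definition is_bar_involution (bar : M N K -> M N K) : Prop :=
  [/\ {morph bar : x y / x + y},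
      forall h x, bar (hecke_act h x) = hecke_act (hecke_bar h) (bar x) &
      forall b0 : lpath N K, b0 = nseq (N - K) false ++ nseq K true :> seq bool ->
        bar (mvec _ b0) = mvec _ b0].

Definition is_basis (C : lpath N K -> M N K) : Prop :=
  forall x, exists! c : {ffun lpath N K -> laurent}, x = \sum_b c b *: C b.

(* P a b is the polynomial with P^-_{a,b}(t^-1) = evalz tinv (P a b). *)
Record is_KL_basis (bar : M N K -> M N K) (C : lpath N K -> M N K)
    (P : lpath N K -> lpath N K -> {poly int}) : Prop := {
  KL_basis : is_basis C;
  KL_bar : forall b, bar (C b) = C b;
  KL_expand : forall b,
    C b = \sum_(a | path_le a b) evalz tinv (P a b) *: mvec _ a;
  KL_diag : forall b, P b b = 1;
  KL_below : forall a b, path_lt a b -> (P a b)`_0 = 0;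
  KL_notle : forall a b, ~~ path_le a b -> P a b = 0 }.

End HeckeAction.

(* Parenthesis matching of the suffix s, read from position i on; stack holds  *)
(* the positions of the currently unmatched opening letters.                   *)
Fixpoint match_parens (stack : seq nat) (i : nat) (s : seq bool) :
    seq (nat * nat) :=
  match s, stack with
  | [::], _ => [::]
  | true :: s', _ => match_parens (i :: stack) i.+1 s'
  | false :: s', j :: stack' => (j, i) :: match_parens stack' i.+1 s'
  | false :: s', [::] => match_parens [::] i.+1 s'
  end.

Definition pairings (w : seq bool) : seq (nat * nat) := match_parens [::] 0 w.

(* For a set S of pairings of w, flip S w is w with the pairings in S flipped. *)
Definition flip (S : seq (nat * nat)) (w : seq bool) : seq bool :=
  [seq if k \in unzip1 S then false else if k \in unzip2 S then true
       else nth false w k | k <- iota 0 (size w)].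

Definition in_flips N K (a b : lpath N K) : Prop :=
  exists2 S, {subset S <= pairings b} & a = flip S b :> seq bool.

Definition dist N K (a b : lpath N K) : nat :=
  (#|[set i : 'I_N | tnth a i != tnth b i]| %/ 2)%N.

(* A box is given by its centre. *)
Definition box : Type := (int * int)%type.

Definition dyck_word (s : seq bool) : bool :=
  (height s (size s) == 0) && all (fun k => 0 <= height s k) (iota 0 (size s).+1).

Definition path_boxes (b : box) (s : seq bool) : {fset box} :=
  [fset (b.1 + k%:Z, b.2 + height s k)%R | k in iota 0 (size s).+1]%fset.

Definition is_dyck_strip (D : {fset box}) : Prop :=
  exists b s, dyck_word s /\ D = path_boxes b s.

Definition between N K (a b : lpath N K) (c : box) : bool :=
  [&& odd `|c.1 + c.2|, 0 < c.1, c.1 < N%:Z,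
      height a `|c.1| + 1 <= c.2 & c.2 <= height b `|c.1| - 1].

(* Heights of a path with N steps lie in [-N, N]. *)
Definition boxes_between N K (a b : lpath N K) : {fset box} :=
  [fset c in [seq (x%:Z, y%:Z - N%:Z)%R | x <- iota 0 N.+1, y <- iota 0 (2 * N)%N.+1]
   | between a b c]%fset.

Definition is_configuration N K (a b : lpath N K) (DD : {fset {fset box}}) : Prop :=
  [/\ fcover DD = boxes_between a b, trivIfset DD &
      forall D, D \in DD -> is_dyck_strip D].

Definition upper_boxes (c : box) : seq box :=
  [:: (c.1, c.2 + 2); (c.1 - 1, c.2 + 1); (c.1 + 1, c.2 + 1)].

Definition ruleII (D D' : {fset box}) : Prop :=
  (exists c c', [/\ c \in D, c' \in D' & c' \in upper_boxes c]) ->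
  forall c c', c \in D -> c' \in upper_boxes c -> (c' \in D) || (c' \in D').

Definition confII N K (a b : lpath N K) (DD : {fset {fset box}}) : Prop :=
  is_configuration a b DD /\
  forall D D', D \in DD -> D' \in DD -> D != D' -> ruleII D D'.

Definition QII N K (a b : lpath N K) : {poly int} :=
  if a == b then 1
  else if path_le a b then
    \sum_(DD <- fpowerset (fpowerset (boxes_between a b)) | `[< confII a b DD >])
      'X^(#|` DD|)
  else 0.

(* Main.v *)
Require Import Defs.
From mathcomp Require Import all_boot all_order perm all_algebra.
From mathcomp Require Import finmap boolp zify ring.
Import Defs.
Set Implicit Arguments.
Unset Strict Implicit.
Unset Printing Implicit Defensive.
Import Order.TTheory GRing.Theory Num.Theory.
Local Open Scope ring_scope.

(** Why the theorem holds.  Both sides are computed independently of each other,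
    and both equal the same explicit polynomial: [t^-d] if [a] is obtained from
    [b] by flipping [d] of its pairings, and [0] otherwise.  This polynomial is
    written [cup_poly [::] a b]; it is the coefficient of [a] in the product over
    the pairings of [b] of the local vectors [21 + t^-1 12], the unpaired letters
    of [b] being kept.

    The Kazhdan-Lusztig side ([KL_cup_poly]).  The operators [e_i = T_i + t^-1]
    are bar invariant and act on words as Temperley-Lieb generators: [e_i] kills
    the words whose letters [i], [i + 1] agree, and sends every word to a
    multiple of [21 + t^-1 12] at these two places.  If [b] has a peak [21] at
    [i], and [b'] has the valley [12] there instead, then [e_i] sends the vector
    of [b'] to the vector of [b] ([cup_op_valley]).  The lowest path has no
    pairing, and its vector is the bar invariant [m_b0]; so all these vectors are
    bar invariant ([bar_cup_vec]).  A bar invariant element of [t^-1 Z[t^-1]] is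
    zero, which forces them to be the given basis ([cup_vec_KL]).

    The Dyck strip side ([QII_cup_poly]).  In the region below [b], give each box
    its level, the number of boxes of the region above it in its column.  Rule II
    makes every strip sit at one constant level [n] below [b]: if a strip is not
    directly below [b], then all of it is covered by a single other strip, which
    moreover extends beyond both of its ends; by induction on the level, a strip
    follows the shape of [b] over the columns between the two letters of a
    pairing of [b] ([rule_II_strip]).  The level of the strip of a pairing has to
    be the number of boxes in the column at the opening letter
    ([conf_strip_level]).  Hence a configuration is determined by the set of
    pairings that carry a strip, these are the pairings at which [a] and [b]
    differ, and [a] is the flip of this set ([conf_is_flip], [conf_unique]).
    Conversely, for a flip these strips do form a configuration satisfying
    Rule II ([flip_confII]), because pairings are nested or disjoint.  So the
    generating function has at most one term, with one factor per flipped
    pairing. *)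

(** * The polynomial of a pair of words *)

(** The coefficient of the two letters [x y] in [21 + t^-1 12], with ['X] for
    [t^-1]. *)
Definition arc_weight (x y : bool) : {poly int} :=
  if x == y then 0 else if x then 1 else 'X.

(** [b] is read from left to right and the letters of [a] that face an opening
    letter of [b] are kept on the stack [st] until their partner is met. A letter
    of [a] facing an unpaired letter of [b] must agree with it, which for the
    letters left on the stack at the end means being an up step. *)
Fixpoint cup_poly (st a b : seq bool) : {poly int} :=
  match b, a, st with
  | true :: b', x :: a', _ => cup_poly (x :: st) a' b'
  | false :: b', x :: a', z :: st' => arc_weight z x * cup_poly st' a' b'
  | false :: b', x :: a', [::] => (~~ x)%:R * cup_poly [::] a' b'
  | _, _, _ => (all id st)%:R
  end.

(** An adjacent pairing is popped as soon as it is pushed, so it contributes a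
    factor and disappears. *)
Lemma cup_poly_peak st a1 x y a2 u w : size a1 = size u ->
  cup_poly st (a1 ++ [:: x, y & a2]) (u ++ [:: true, false & w]) =
  arc_weight x y * cup_poly st (a1 ++ a2) (u ++ w).
Proof.
elim: u a1 st => [|[] u IHu] [|z a1] st //= [] szE; first by rewrite IHu.
by case: st => [|c st]; rewrite IHu // mulrCA.
Qed.

(** The bottom of the stack is met only after all of [st] is popped; an up letter
    there then imposes the condition that an empty stack imposes. *)
Lemma cup_poly_rcons_up st a b : size a = size b ->
  cup_poly (rcons st true) a b = cup_poly st a b.
Proof.
elim: b a st => [|[] b IHb] [|x a] st //=.
- by rewrite all_rcons.
- by case=> szE; rewrite -rcons_cons IHb.
case=> szE; case: st => [|c st] /=; last by rewrite IHb.
by case: x; rewrite ?mul0r // (IHb a [::]).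
Qed.

(** This is [e_i] applied at a valley, at the level of coefficients. Reading [u]
    reduces the claim to the case where the valley comes first. If the stack is
    not empty, its top letter [c] is paired with the closing letter of the valley
    and is replaced by the letter of [a] that faces the opening one: only one of
    the two terms survives, and it leaves the stack unchanged. *)
Lemma cup_poly_valley st a1 a2 u w : size a1 = size u -> size a2 = size w ->
  'X * cup_poly st (a1 ++ [:: false, true & a2]) (u ++ [:: false, true & w]) +
  cup_poly st (a1 ++ [:: true, false & a2]) (u ++ [:: false, true & w]) =
  'X * cup_poly st (a1 ++ a2) (u ++ w).
Proof.
move=> + sz2; elim: u a1 st => [|[] u IHu] [|z a1] st //=.
- case: st => [|c st] _; rewrite /arc_weight /=.
    by rewrite mul1r mul0r addr0 (cup_poly_rcons_up [::]).
  by case: c; rewrite /= ?mul1r ?mul0r ?mulr0 ?add0r ?addr0.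
- by case=> sz1; rewrite IHu.
case=> sz1; case: st => [|c st].
  by rewrite !(mulrCA 'X) -mulrDr IHu.
by rewrite !(mulrCA 'X) -mulrDr IHu.
Qed.

(** Each flipped pairing brings a factor ['X], so only [a = b] has a constant
    term. *)
Lemma cup_poly_coef0 st a b : size a = size b ->
  (cup_poly st a b)`_0 = (all id st && (a == b))%:R.
Proof.
elim: b a st => [|[] b IHb] [|x a] st //=.
- by move=> _; rewrite andbT; case: all; rewrite ?coef1 ?coef0.
- by case=> szE; rewrite IHb //= eqseq_cons eqb_id andbCA andbA.
case=> szE; rewrite eqseq_cons eqbF_neg; case: st => [|c st].
  by rewrite coef0M IHb //=; case: x; rewrite ?coef0 ?coef1 ?mul0r ?mul1r.
rewrite coef0M IHb // /arc_weight; case: c; case: x => /=;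
  by rewrite ?coef0 ?coef1 ?coefX ?mul0r ?mul1r ?andbF.
Qed.

Lemma cup_poly_up st a q : size a = q ->
  cup_poly st a (nseq q true) = (all id st && (a == nseq q true))%:R.
Proof.
elim: q a st => [|q IHq] [|x a] st //=; first by rewrite andbT.
by case=> szE; rewrite IHq //= eqseq_cons eqb_id andbCA andbA.
Qed.

Lemma cup_poly_no_peak p q a : size a = (p + q)%N ->
  cup_poly [::] a (nseq p false ++ nseq q true) =
  (a == nseq p false ++ nseq q true)%:R.
Proof.
elim: p a => [|p IHp] a; first by move=> szE; rewrite cup_poly_up.
case: a => [|x a] //= [szE]; rewrite IHp // eqseq_cons.
by case: x; rewrite /= ?mul0r ?mul1r.
Qed.

(** The inductive step of the bar invariance uses a peak, and the base case a word
    without peak. *)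
Lemma peak_or_sorted (w : seq bool) :
  (exists u v, w = u ++ [:: true, false & v]) \/
  (exists p q, w = nseq p false ++ nseq q true).
Proof.
elim: w => [|x w [[u [v ->]]|[p [q ->]]]]; first by right; exists 0%N, 0%N.
  by left; exists (x :: u), v.
case: x; last by right; exists p.+1, q.
by case: p => [|p]; [right; exists 0%N, q.+1 | left; exists [::], (nseq p false ++ nseq q true)].
Qed.

Lemma cup_poly_diag b st : all id st -> cup_poly st b b = 1.
Proof.
elim: b st => [|[] b IHb] st /=; first by move=> ->.
  by move=> stT; apply: IHb.
case: st => [_|c st /andP[-> stT]]; first by rewrite mul1r IHb.
by rewrite mul1r IHb.
Qed.

(** * The order on lattice paths *)

Lemma heightS w k : (k < size w)%N ->
  height w k.+1 = height w k + step_sign (nth false w k).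
Proof.
by move=> kw; rewrite /height (take_nth false kw) -cats1 big_cat big_seq1.
Qed.

Lemma height0 w : height w 0 = 0.
Proof. by rewrite /height take0 big_nil. Qed.

Section PathOrder.
Variables N K : nat.
Implicit Types a b : lpath N K.

Lemma path_leP a b :
  reflect (forall x, (x <= N)%N -> height a x <= height b x) (path_le a b).
Proof.
apply: (iffP forallP) => [le_ab x xN|le_ab x]; last by apply: le_ab; rewrite -ltnS.
exact: (le_ab (Ordinal (xN : (x < N.+1)%N))).
Qed.

Lemma height_inj a b : (forall x, (x <= N)%N -> height a x = height b x) -> a = b.
Proof.
move=> hab; apply/val_inj/val_inj/(@eq_from_nth _ false) => [|k].
  by rewrite !size_tuple.
rewrite size_tuple => kN; have := hab _ kN.
rewrite !heightS ?size_tuple // hab ?(ltnW kN) // => /addrI.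
by case: (nth _ _ _); case: (nth _ _ _).
Qed.

Lemma path_le_trans b a c : path_le a b -> path_le b c -> path_le a c.
Proof.
move=> /path_leP ab /path_leP bc; apply/path_leP => x xN.
exact: le_trans (ab x xN) (bc x xN).
Qed.

Lemma path_le_anti a b : path_le a b -> path_le b a -> a = b.
Proof.
move=> /path_leP ab /path_leP ba; apply: height_inj => x xN.
by apply/eqP; rewrite eq_le ab ?ba.
Qed.

Lemma path_lt_trans b a c : path_lt a b -> path_lt b c -> path_lt a c.
Proof.
move=> /andP[nab ab] /andP[nbc bc]; rewrite /path_lt (path_le_trans ab bc) andbT.
by apply: contraNneq nab => ac; subst c; rewrite (path_le_anti ab bc).
Qed.

Lemma path_lt_ind (P : lpath N K -> Prop) :
  (forall b, (forall a, path_lt a b -> P a) -> P b) -> forall b, P b.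
Proof.
move=> IH b; have [n] := ubnP #|[pred a | path_lt a b]|.
elim: n b => // n IHn b; rewrite ltnS => le_bn; apply: IH => a ab; apply: IHn.
apply: leq_trans le_bn; apply/proper_card/properP; split.
  by apply/subsetP => c; rewrite !inE => /path_lt_trans; apply.
by exists a; rewrite !inE // /path_lt eqxx.
Qed.

Lemma path_gt_ind (P : lpath N K -> Prop) :
  (forall a, (forall b, path_lt a b -> P b) -> P a) -> forall a, P a.
Proof.
move=> IH a; have [n] := ubnP #|[pred b | path_lt a b]|.
elim: n a => // n IHn a; rewrite ltnS => le_an; apply: IH => b ab; apply: IHn.
apply: leq_trans le_an; apply/proper_card/properP; split.
  by apply/subsetP => c; rewrite !inE; apply: path_lt_trans.
by exists b; rewrite !inE // /path_lt eqxx.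
Qed.
End PathOrder.

(** * The Temperley-Lieb action on the module *)

Lemma split_word (w : seq bool) i : (i.+1 < size w)%N ->
  w = take i w ++ [:: nth false w i, nth false w i.+1 & drop i.+2 w].
Proof.
by move=> iw; rewrite -!drop_nth ?cat_take_drop // ltnW.
Qed.

Lemma evalz0 c : evalz c 0 = 0.
Proof. by rewrite /evalz rmorph0 horner0. Qed.

Lemma evalzX c : evalz c 'X = c.
Proof. by rewrite /evalz map_polyX hornerX. Qed.

Lemma evalzD c p q : evalz c (p + q) = evalz c p + evalz c q.
Proof. by rewrite /evalz rmorphD hornerD. Qed.

Section CanonicalBasis.
Variables N K : nat.
Local Notation M := (pmod laurent N K).
Implicit Types (a b : lpath N K) (i : 'I_N.-1).

Definition cup_vec b : M :=
  [ffun a : lpath N K => evalz tinv (cup_poly [::] a b) : laurent^o].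

(** The letters of [a] before and after the steps [i] and [i + 1]. *)
Definition around i a := (take i a, drop i.+2 a).

Lemma word_around i a :
  a = (around i a).1 ++
      [:: tnth a (lo i), tnth a (hi i) & (around i a).2] :> seq bool.
Proof.
by rewrite !(tnth_nth false) /= -split_word // size_tuple; apply: hi_subproof.
Qed.

Lemma exchange_around i a : exchange i a = (around i a).1 ++
  [:: tnth a (hi i), tnth a (lo i) & (around i a).2] :> seq bool.
Proof.
have iN : (i.+1 < N)%N by apply: hi_subproof.
have sz : size (take i a) = i by rewrite size_take size_tuple ltnW // ltnW.
apply: (@eq_from_nth _ false) => [|k].
  by rewrite size_tuple size_cat /= sz size_drop size_tuple; lia.
rewrite size_tuple => kN.
have -> : nth false (exchange i a) k = tnth (exchange i a) (Ordinal kN).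
  by rewrite (tnth_nth false).
rewrite tnth_exchange nth_cat sz; case: tpermP => [/(congr1 val) /= ->|/(congr1 val) /= ->|].
- by rewrite ltnn subnn.
- by rewrite ltnNge leqnSn /= subSn // subnn.
rewrite (tnth_nth false) /= => /eqP; rewrite -val_eqE /= => k1 /eqP; rewrite -val_eqE /= => k2.
case: ltnP => ki; first by rewrite nth_take.
have -> : (k - i)%N = (k - i.+2).+2 by lia.
by rewrite /= nth_drop; congr nth; lia.
Qed.

Lemma size_around i a b : size (around i a).1 = size (around i b).1 /\
  size (around i a).2 = size (around i b).2.
Proof. by rewrite !size_take !size_drop !size_tuple. Qed.

Lemma gen_act_coef i (x : M) a : gen_act tvar tinv i x a =
  coefA tvar tinv (tnth a (lo i)) (tnth a (hi i)) * x a +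
  coefB laurent (tnth a (hi i)) (tnth a (lo i)) * x (exchange i a).
Proof.
rewrite /gen_act sum_ffunE.
have E c : (x c *: gen_on_basis tvar tinv i c) a =
    x c * (coefA tvar tinv (tnth c (lo i)) (tnth c (hi i)) * (a == c)%:R) +
    x c * (coefB laurent (tnth c (lo i)) (tnth c (hi i)) * (a == exchange i c)%:R).
  by rewrite -gen_act_mvec gen_actE !ffunE -mulrDr.
under eq_bigr do rewrite E.
rewrite big_split /= (bigD1 a) //= big1 => [|c ca]; last first.
  by rewrite eq_sym (negPf ca) !mulr0.
rewrite (bigD1 (exchange i a)) //= big1 => [|c ca]; last first.
  rewrite [a == _]eq_sym (_ : _ == a = false) ?mulr0 //.
  by apply: contraNF ca => /eqP <-; rewrite exchangeK.
by rewrite exchangeK !eqxx !addr0 !mulr1 !tnth_exchange tpermL tpermR mulrC [x _ * _]mulrC.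
Qed.

(** [e_i = T_i + t^-1], a generator of the Temperley-Lieb algebra up to
    normalisation. *)
Definition cup_op i (x : M) : M := gen_act tvar tinv i x + tinv *: x.

Lemma cup_op_coef i (x : M) a : cup_op i x a =
  if tnth a (lo i) == tnth a (hi i) then 0 else
  (if tnth a (lo i) then tvar else tinv) * x a + x (exchange i a).
Proof.
rewrite !ffunE gen_act_coef -[tinv *: _]/(tinv * x a) /coefA /coefB.
by case: (tnth a (lo i)); case: (tnth a (hi i)) => /=; ring.
Qed.

(** [e_i] closes the two strands at [i] and [i + 1] by a cup and joins their former
    partners. Both sides satisfy the same linear relations between the
    coefficients of [..21..] and [..12..], so only one coefficient has to be
    compared, and that is [cup_poly_valley]. *)
Lemma cup_op_valley i b : tnth b (lo i) = false -> tnth b (hi i) = true ->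
  cup_op i (cup_vec b) = cup_vec (exchange i b).
Proof.
move=> lo0 hi1; apply/ffunP => a; rewrite cup_op_coef !ffunE.
have [sz1 sz2] := size_around i a b.
rewrite (exchange_around i b) lo0 hi1 [in RHS](word_around i a) cup_poly_peak //.
case: eqVneq => [->|ne]; first by rewrite /arc_weight eqxx mul0r evalz0.
have := congr1 (evalz tinv) (cup_poly_valley [::] sz1 sz2).
rewrite evalzD !evalzM evalzX.
rewrite (word_around i b) lo0 hi1 (exchange_around i a) [in cup_poly _ a _](word_around i a).
case: (tnth a (lo i)) (tnth a (hi i)) ne => [] [] //= _ E.
  by rewrite /arc_weight /= evalz1 mul1r -[RHS]mul1r -tvarK -mulrA -E mulrDr mulrA tvarK; ring.
by rewrite /arc_weight /= evalzX -E.
Qed.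
End CanonicalBasis.

(** * Bar invariance and uniqueness *)

Lemma evalz_tvar_inj : injective (evalz tvar).
Proof.
move=> p q /(congr1 val); rewrite !val_evalz => /eqP.
by rewrite tofrac_eq => /eqP.
Qed.

Lemma laurent_bar_evalz p : laurent_bar (evalz tinv p) = evalz tvar p.
Proof.
rewrite /evalz -horner_map /= laurent_bar_tinv -map_poly_comp; congr (_.[_]).
by apply: eq_map_poly => c /=; rewrite rmorph_int.
Qed.

Lemma evalz_tinv_reverse (p : {poly int}) n : (size p <= n.+1)%N ->
  evalz tinv p * tvar ^+ n = evalz tvar (\poly_(i < n.+1) p`_(n - i)).
Proof.
move=> pn; have sz (q : {poly int}) : (size (map_poly intr q : {poly laurent}) <= size q)%N.
  exact: size_poly.
rewrite /evalz (horner_coef_wide _ (leq_trans (sz p) pn)) mulr_suml.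
rewrite (horner_coef_wide _ (leq_trans (sz _) (size_poly _ _))).
rewrite (reindex_inj rev_ord_inj) /=; apply: eq_bigr => i _.
have le_in : (i <= n)%N by rewrite -ltnS.
rewrite !coef_map_id0 ?rmorph0 // coef_poly ltn_ord subSS -mulrA; congr (_ * _).
rewrite -[in tvar ^+ n](subnK le_in) exprD mulrA.
by rewrite tinvKX mul1r.
Qed.

(** With [d] the degree of [p], invariance says that [t^d p(t)] is the reversal of
    [p]. The latter has degree at most [d], so [d = 0] and [p] is constant. *)
Lemma bar_fixed_eq0 (p : {poly int}) :
  p`_0 = 0 -> laurent_bar (evalz tinv p) = evalz tinv p -> p = 0.
Proof.
move=> p0 pbar; apply/eqP; apply: contraT => pn0.
have sz : size p = (size p).-1.+1 by rewrite prednK // lt0n size_poly_eq0.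
have := @evalz_tinv_reverse p (size p).-1; rewrite -sz => /(_ (leqnn _)).
rewrite -pbar laurent_bar_evalz -evalzXn -evalzM => /evalz_tvar_inj E.
have := size_poly (size p) (fun i => p`_((size p).-1 - i)); rewrite -E size_mulXn //.
rewrite -[X in (_ <= X)%N]add0n leq_add2r leqn0 => /eqP sz0.
by move: pn0; rewrite [p]size1_polyC ?p0 ?eqxx // sz sz0.
Qed.

Section BarInvariance.
Variables N K : nat.
Local Notation M := (pmod laurent N K).
Variable bar : M -> M.
Hypothesis bar_inv : is_bar_involution bar.
Implicit Types (a b : lpath N K) (i : 'I_N.-1) (x y : M).

Lemma barD x y : bar (x + y) = bar x + bar y.
Proof. by case: bar_inv => morD _ _; exact: morD. Qed.

Lemma barZ c x : bar (c *: x) = laurent_bar c *: bar x.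
Proof.
case: bar_inv => _ barH _.
by rewrite -hecke_act_scal barH hecke_bar_scal hecke_act_scal.
Qed.

Lemma bar0 : bar 0 = 0.
Proof. by have := barZ 0 0; rewrite rmorph0 !scale0r. Qed.

Lemma cup_op_hecke i x : cup_op i x = hecke_act (hgen i + tinv%:A) x.
Proof. by rewrite hecke_actDl hecke_act_gen hecke_act_scal. Qed.

(** The bar involution exchanges [T_i + t^-1] with [T_i^-1 + t], which is the same
    element by the quadratic relation. *)
Lemma bar_cup_op i x : bar (cup_op i x) = cup_op i (bar x).
Proof.
case: bar_inv => _ barH _; rewrite !cup_op_hecke barH; congr hecke_act.
rewrite rmorphD /= hecke_bar_gen hecke_bar_scal laurent_bar_tinv /hgenV.
by rewrite scalerBl opprB -addrA subrK.
Qed.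

Lemma count_word b : (count id b = K)%N.
Proof.
have hw (w : seq bool) : height w (size w) = (count id w)%:Z *+ 2 - (size w)%:Z.
  rewrite /height take_size; elim: w => [|x w IHw]; first by rewrite big_nil.
  by rewrite big_cons IHw /=; case: x => /=; lia.
have := hw b; rewrite size_tuple.
have /eqP -> := wordP b; lia.
Qed.

Lemma cup_vec_lowest b p q : b = nseq p false ++ nseq q true :> seq bool ->
  cup_vec b = mvec laurent b.
Proof.
move=> bE; apply/ffunP => a; rewrite !ffunE bE cup_poly_no_peak; last first.
  by rewrite -{1}(size_nseq p false) -(size_nseq q true) -size_cat -bE !size_tuple.
rewrite -bE -[_ == _ :> seq _]/(a == b).
by case: eqP => _; rewrite ?evalz1 ?evalz0.
Qed.

Lemma peak_exchange b u w : b = u ++ [:: true, false & w] :> seq bool ->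
  exists i : 'I_N.-1, [/\ tnth b (lo i) = true & tnth b (hi i) = false].
Proof.
move=> bE; have uN : (size u < N.-1)%N.
  by have := size_tuple b; rewrite bE size_cat /=; lia.
exists (Ordinal uN); rewrite !(tnth_nth false) /= bE.
by rewrite !nth_cat ltnn subnn ltnNge leqnSn subSn // subnn.
Qed.

(** Lowering a peak of [b] to a valley gives a smaller path, whose vector is sent
    to that of [b] by the bar invariant operator [cup_op i]. *)
Lemma bar_cup_vec b : bar (cup_vec b) = cup_vec b.
Proof.
elim/path_lt_ind: b => b IHb.
have [[u [w /peak_exchange[i [bl bh]]]]|[p [q bE]]] := peak_or_sorted b.
  have lo0 : tnth (exchange i b) (lo i) = false by rewrite tnth_exchange tpermL.
  have hi1 : tnth (exchange i b) (hi i) = true by rewrite tnth_exchange tpermR.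
  have lt_b : path_lt (exchange i b) b.
    by have := @exchange_lt _ K i (exchange i b); rewrite lo0 hi1 exchangeK; apply.
  by rewrite -[in LHS](exchangeK i b) -cup_op_valley // bar_cup_op IHb // cup_op_valley // exchangeK.
rewrite (cup_vec_lowest bE); case: bar_inv => _ _; apply; rewrite bE.
have qK : q = K by have := count_word b; rewrite bE count_cat !count_nseq; lia.
have pN : p = (N - K)%N.
  by have := size_tuple b; rewrite bE size_cat !size_nseq; lia.
by rewrite pN qK.
Qed.

End BarInvariance.

Section Uniqueness.
Variables N K : nat.
Local Notation M := (pmod laurent N K).
Variables (bar : M -> M) (C : lpath N K -> M) (P : lpath N K -> lpath N K -> {poly int}).
Hypotheses (bar_inv : is_bar_involution bar) (KL : is_KL_basis bar C P).
Implicit Types (a b : lpath N K).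

Lemma KL_coef a b : C b a = evalz tinv (P a b).
Proof.
rewrite (KL_expand KL) sum_ffunE; case ab: (path_le a b); last first.
  rewrite (KL_notle KL) ?ab // big1 => [|c cb].
    by rewrite evalz0.
  by rewrite !ffunE; case: eqP => [ac|_]; [rewrite ac cb in ab | rewrite [LHS]mulr0].
rewrite (bigD1 a) //= big1 => [|c /andP[_ ca]].
  by rewrite !ffunE eqxx addr0 [LHS]mulr1.
by rewrite !ffunE eq_sym (negPf ca) [LHS]mulr0.
Qed.

(** Expand [cup_vec b] on the basis [C]. The coefficients [c] are bar invariant by
    uniqueness of the expansion. By induction from the highest paths down, [c a]
    differs from the coefficient of [a] in [cup_vec b] by [P a b] only, so it lies
    in [t^-1 Z[t^-1]] for [a != b], hence vanishes. *)
Lemma cup_vec_KL b : C b = cup_vec b.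
Proof.
have [c [cE c_uniq]] := KL_basis KL (cup_vec b).
have c_bar a : laurent_bar (c a) = c a.
  suff {2}-> : c = [ffun a => laurent_bar (c a)] by rewrite ffunE.
  apply: c_uniq; rewrite -(bar_cup_vec bar_inv) {1}cE.
  rewrite (big_morph _ (barD bar_inv) (bar0 bar_inv)); apply: eq_bigr => d _.
  by rewrite (barZ bar_inv) (KL_bar KL) ffunE.
suff c_delta a : c a = (a == b)%:R.
  rewrite cE (bigD1 b) //= c_delta eqxx scale1r big1 ?addr0 // => a ab.
  by rewrite c_delta (negPf ab) scale0r.
elim/path_gt_ind: a => a IHa.
have : cup_vec b a = c a + (a != b)%:R * evalz tinv (P a b).
  rewrite cE sum_ffunE (bigD1 a) //= !ffunE KL_coef (KL_diag KL) evalz1.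
  rewrite [_ *: _]mulr1; congr (_ + _).
  have E d : d != a -> (c d *: C d) a = (d == b)%:R * evalz tinv (P a b).
    move=> da; rewrite !ffunE KL_coef -[LHS]/(c d * _).
    case ad: (path_le a d); last first.
      rewrite (KL_notle KL) ?ad // evalz0 mulr0.
      case: eqP => [db|_]; rewrite ?mul0r //.
      by rewrite -db (KL_notle KL) ?ad // evalz0 mulr0.
    by rewrite IHa ?/path_lt 1?eq_sym ?da //; case: eqP => [->|]; rewrite ?mul0r.
  rewrite (eq_bigr _ E); have [->|ab] := eqVneq a b.
    by rewrite mul0r big1 // => d /negPf ->; rewrite mul0r.
  rewrite (bigD1 b) 1?eq_sym //= eqxx big1 ?addr0 // => d /andP[_ /negPf ->].
  by rewrite mul0r.
rewrite ffunE; have [->|ab] := eqVneq a b.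
  by rewrite mul0r addr0 cup_poly_diag // evalz1.
rewrite mul1r => /eqP; rewrite -subr_eq -evalzB => /eqP caE.
have szE : size a = size b by rewrite !size_tuple.
move: (c_bar a); rewrite -caE => /bar_fixed_eq0 ->; first by rewrite evalz0.
rewrite poly.coefB cup_poly_coef0 //= -[_ == _ :> seq _]/(a == b) (negPf ab).
case le_ab: (path_le a b); last by rewrite (KL_notle KL) ?le_ab // coef0 subrr.
by rewrite (KL_below KL) ?subrr // /path_lt ab.
Qed.

Lemma KL_cup_poly a b : evalz tinv (P a b) = evalz tinv (cup_poly [::] a b).
Proof. by rewrite -KL_coef cup_vec_KL ffunE. Qed.
End Uniqueness.

(** * Pairings described by heights *)

(** The positions that the parenthesis matching leaves alone, computed along the
    same recursion as the pairings. *)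
Fixpoint match_rest (st : seq nat) (i : nat) (s : seq bool) : seq nat :=
  match s, st with
  | [::], _ => st
  | true :: s', _ => match_rest (i :: st) i.+1 s'
  | false :: s', _ :: st' => match_rest st' i.+1 s'
  | false :: s', [::] => i :: match_rest [::] i.+1 s'
  end.

Definition unpaired (w : seq bool) : seq nat := match_rest [::] 0 w.

Lemma match_parens_perm st i s :
  perm_eq (unzip1 (match_parens st i s) ++ unzip2 (match_parens st i s) ++
           match_rest st i s)
          (st ++ iota i (size s)).
Proof.
elim: s st i => [|[] s IHs] st i /=; first by rewrite cats0.
  apply/seq.permP => P; have /seq.permP/(_ P) := IHs (i :: st) i.+1.
  by rewrite !count_cat /=; lia.
case: st => [|j st] /=; apply/seq.permP => P.
  by have /seq.permP/(_ P) := IHs [::] i.+1; rewrite /= !count_cat /=; lia.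
by have /seq.permP/(_ P) := IHs st i.+1; rewrite /= !count_cat /= count_cat /=; lia.
Qed.

(** Geometrically, a pairing is a horizontal chord under the path: the path goes
    up at [p.1], stays strictly above, and returns at [p.2] to the height it had
    before. Nesting and disjointness are read off this description. *)
Definition matched (w : seq bool) (p : nat * nat) : Prop :=
  [/\ (p.1 < p.2)%N, (p.2 < size w)%N, height w p.2.+1 = height w p.1 &
      forall k, (p.1 < k <= p.2)%N -> height w p.1 < height w k].

(** Invariant of the matching: the open letters on the stack are those from which
    the path has not come back yet, so their heights decrease by one from the top
    of the stack to the bottom. *)
Definition open_stack (w : seq bool) (i : nat) (st : seq nat) : Prop :=
  (forall n, (n < size st)%N -> height w (nth 0%N st n) = height w i - 1 - n%:Z) /\
  (forall j, j \in st ->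
     (j < i)%N /\ forall k, (j < k <= i)%N -> height w j < height w k).

Lemma match_parens_sound w st i s :
  s = drop i w -> (i + size s)%N = size w -> open_stack w i st ->
  (forall p, p \in match_parens st i s -> matched w p) /\
  (forall j, j \in match_rest st i s ->
     nth false w j = true -> forall k, (j < k <= size w)%N ->
     height w j < height w k).
Proof.
elim: s st i => [|x s IHs] st i /=.
  rewrite addn0 => _ -> [_ st_low]; split=> // j /st_low[_ low] _ k; exact: low.
move=> sE szE [st_h st_low].
have iw : (i < size w)%N by lia.
move: sE; rewrite (drop_nth false iw) => -[xE sE].
have szE' : (i.+1 + size s)%N = size w by lia.
have hS := heightS iw; rewrite -xE in hS.
case: x xE hS => xE hS.
  apply: IHs => //; split=> [[|n]|j] /=.
  - by move=> _; rewrite hS /=; lia.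
  - by rewrite ltnS => /st_h ->; rewrite hS /=; lia.
  rewrite inE => /orP[/eqP ->|/st_low[ji low]].
    split=> // k ik; have -> : k = i.+1 by lia.
    by rewrite hS /=; lia.
  split=> [|k jk]; first by lia.
  have [->|ki] := eqVneq k i.+1.
    by rewrite hS /=; have := low i; rewrite ji leqnn => /(_ isT); lia.
  by apply: low; lia.
case: st st_h st_low => [|j st] st_h st_low /=.
  have [|sound rest] := IHs [::] i.+1 sE szE'; first by split.
  split=> // j; rewrite inE => /orP[/eqP ->|]; last exact: rest.
  by rewrite -xE.
have [ji low] := st_low j (mem_head _ _).
have hj : height w j = height w i - 1 by rewrite (st_h 0%N) // subr0.
have [|sound rest] := IHs st i.+1 sE szE'.
  split=> [n nst|k kst].
    by rewrite (st_h n.+1) // hS /=; lia.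
  have [|ki klow] := st_low k; first by rewrite inE kst orbT.
  split=> [|l kl]; first exact: ltnW.
  have [->|li] := eqVneq l i.+1; last by apply: klow; lia.
  have kn : (index k st < size st)%N by rewrite index_mem.
  have := st_h (index k st).+1 kn; rewrite /= nth_index // hS /=; lia.
split=> // p; rewrite inE => /orP[/eqP ->|]; last exact: sound.
by split=> //=; rewrite hS hj /=; lia.
Qed.

Section Pairings.
Variable w : seq bool.
Implicit Types p q : nat * nat.

Lemma pairings_perm :
  perm_eq (unzip1 (pairings w) ++ unzip2 (pairings w) ++ unpaired w)
          (iota 0 (size w)).
Proof. exact: match_parens_perm. Qed.

Lemma matched_up p : matched w p -> nth false w p.1 = true.
Proof.
case=> p12 p2w _ low; have := low p.1.+1; rewrite leqnn p12 => /(_ isT).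
by rewrite heightS ?(ltn_trans p12) //; case: nth => //=; lia.
Qed.

Lemma matched_down p : matched w p -> nth false w p.2 = false.
Proof.
case=> p12 p2w hE low; have := low p.2; rewrite leqnn p12 => /(_ isT).
by rewrite -hE heightS //; case: nth => //=; lia.
Qed.

Lemma matched_nested p q : matched w p -> matched w q ->
  (p.1 < q.1 <= p.2)%N -> (q.2 < p.2)%N.
Proof.
case=> _ _ hp lowp [_ _ hq lowq] pq; have := lowp _ pq.
case: ltngtP => // [lt|eq]; first by have := lowq p.2.+1; rewrite hp; lia.
by rewrite -hq eq hp; lia.
Qed.

Lemma matched_inj1 p q : matched w p -> matched w q -> p.1 = q.1 -> p = q.
Proof.
case: p q => [i j] [i' j'] [/= ij _ hp lowp] [/= ij' _ hq lowq] E; subst i'.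
congr pair; case: (ltngtP j j') => // lt.
  by have := lowq j.+1; rewrite hp; lia.
by have := lowp j'.+1; rewrite hq; lia.
Qed.

Lemma matched_inj2 p q : matched w p -> matched w q -> p.2 = q.2 -> p = q.
Proof.
move=> mp mq E; apply: matched_inj1 => //.
have [p12 _ _ _] := mp; have [q12 _ _ _] := mq.
case: (ltngtP p.1 q.1) => // lt.
  by have := matched_nested mp mq; lia.
by have := matched_nested mq mp; lia.
Qed.

Lemma pairings_matched p : p \in pairings w -> matched w p.
Proof.
have [|sound _] := @match_parens_sound w [::] 0 w (esym (drop0 w)) erefl.
  by split.
exact: sound.
Qed.

(** The opening letter of a chord is paired by the algorithm, since otherwise the
    path would never come back to its height; its partner is then unique. *)
Lemma matched_pairings p : matched w p -> p \in pairings w.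
Proof.
move=> mp; have [p12 p2w hE _] := mp.
have : p.1 \in iota 0 (size w) by rewrite mem_iota; lia.
rewrite -(perm_mem pairings_perm) !mem_cat => /or3P[].
- case/mapP => q qw E.
  by rewrite (matched_inj1 mp (pairings_matched qw) E).
- case/mapP => q /pairings_matched/matched_down E E'.
  by move: (matched_up mp); rewrite E' E.
have [|_ rest] := @match_parens_sound w [::] 0 w (esym (drop0 w)) erefl.
  by split.
by move=> /rest/(_ (matched_up mp) p.2.+1); rewrite hE; lia.
Qed.

(** Every position is an opening letter, a closing letter or unpaired, exactly
    once. *)
Lemma count_endpoint k : (k < size w)%N ->
  (count_mem k (unzip1 (pairings w)) + count_mem k (unzip2 (pairings w)) +
   count_mem k (unpaired w) = 1)%N.
Proof.
move=> kw; have /seq.permP/(_ (pred1 k)) := pairings_perm.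
by rewrite !count_cat addnA => ->; rewrite count_uniq_mem ?iota_uniq // mem_iota kw.
Qed.

Lemma pairings_uniq : uniq (pairings w).
Proof.
apply: (@map_uniq _ _ (fun p => p.1)).
have := iota_uniq 0 (size w); rewrite -(perm_uniq pairings_perm).
by rewrite cat_uniq => /andP[].
Qed.

Lemma unpairedN p k : p \in pairings w -> k \in unpaired w -> k != p.1 /\ k != p.2.
Proof.
move=> pw; have := iota_uniq 0 (size w); rewrite -(perm_uniq pairings_perm).
rewrite !cat_uniq has_cat => /and5P[_ /norP[_ /hasPn d1] _ /hasPn d2 _] ku.
split; apply: contraTneq ku => ->.
  by apply/negP => /d1; rewrite map_f.
by apply/negP => /d2; rewrite map_f.
Qed.
End Pairings.

(** * Flips of pairings *)

Section Flips.
Variables a b : seq bool.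
Hypothesis szE : size a = size b.
Implicit Types p q : nat * nat.

(** Membership of [a] in the set of flips of [b], read on the letters: the two
    letters of [a] facing a pairing are opposite, the others are those of [b]. *)
Definition is_flip : bool :=
  all (fun p => nth false a p.1 != nth false a p.2) (pairings b) &&
  all (fun k => nth false a k == nth false b k) (unpaired b).

Definition flipped : seq (nat * nat) :=
  [seq p <- pairings b | ~~ nth false a p.1].

Lemma cup_poly_prod st i s : s = drop i b -> (i + size s)%N = size b ->
  all (nth false b) st ->
  cup_poly [seq nth false a j | j <- st] (drop i a) s =
  (\prod_(p <- match_parens st i s) arc_weight (nth false a p.1) (nth false a p.2)) *
  \prod_(k <- match_rest st i s) (nth false a k == nth false b k)%:R.
Proof.
elim: s st i => [|x s IHs] st i /=.
  rewrite addn0 => _ -> stT; rewrite drop_oversize ?szE //= big_nil mul1r.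
  elim: st stT => [|j st IHst] /=; rewrite ?big_nil // big_cons.
  by case/andP => -> /IHst <-; rewrite eqb_id; case: (nth _ a j); rewrite ?mul1r ?mul0r.
move=> sE szE' stT; have ib : (i < size b)%N by lia.
move: sE; rewrite (drop_nth false ib) => -[xE sE].
rewrite (drop_nth false) ?szE //.
have szE2 : (i.+1 + size s)%N = size b by lia.
case: x xE => xE.
  by rewrite -(IHs (i :: st)) //= -xE.
case: st stT => [|j st] /=.
  move=> _; rewrite (IHs [::]) // big_cons mulrCA -xE; case: (nth _ a i); by rewrite ?mul0r ?mulr0.
by case/andP=> _ stT; rewrite IHs // big_cons mulrA.
Qed.

Lemma cup_polyE :
  cup_poly [::] a b = if is_flip then 'X^(size flipped) else 0.
Proof.
have := @cup_poly_prod [::] 0 b (esym (drop0 b)) erefl isT; rewrite drop0 => ->.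
rewrite -/(pairings b) -/(unpaired b) /is_flip /flipped.
have -> (s : seq nat) : \prod_(k <- s) (nth false a k == nth false b k)%:R =
    (all (fun k => nth false a k == nth false b k) s)%:R :> {poly int}.
  elim: s => [|k s IHs]; rewrite ?big_nil // big_cons IHs /=.
  by case: eqP; rewrite ?mul0r ?mul1r.
elim: (pairings b) => [|p s IHs] /=.
  by rewrite big_nil mul1r; case: all.
rewrite big_cons -mulrA IHs /arc_weight.
case: eqP => //= _; first by rewrite mul0r.
by case: (nth _ a p.1); rewrite ?mul1r //=; case: ifP; rewrite ?mulr0 // exprS.
Qed.

Definition covers (x : nat) p : bool := (p.1 < x <= p.2)%N.

Hypothesis fl : is_flip.

Lemma flippedP p : p \in flipped -> matched b p /\ nth false a p.1 = false.
Proof. by rewrite mem_filter => /andP[/negPf ap /pairings_matched]. Qed.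

(** Flipping [p] lowers the path by two exactly over the abscissas that [p]
    covers. *)
Lemma is_flip_height x : (x <= size b)%N ->
  height b x = height a x + (count (covers x) flipped)%:Z *+ 2.
Proof.
elim: x => [|x IHx] xb; first by rewrite !height0 (@eq_count _ _ pred0) ?count_pred0.
have E : (count (covers x.+1) flipped + count_mem x (unzip2 flipped) =
          count (covers x) flipped + count_mem x (unzip1 flipped))%N.
  have : all (fun p => p.1 < p.2)%N flipped.
    by apply/allP => p /flippedP[[]].
  elim: flipped => //= p s IHs /andP[p12 /IHs E].
  have : (covers x.+1 p + (p.2 == x) = covers x p + (p.1 == x))%N.
    by rewrite /covers; lia.
  by rewrite /=; lia.
have E1 : count_mem x (unzip1 flipped) =
    (~~ nth false a x * count_mem x (unzip1 (pairings b)))%N.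
  rewrite /flipped; elim: (pairings b) => [|p s IHs] /=; first by rewrite muln0.
  case ap: (nth false a p.1); rewrite /= IHs; case: eqVneq => [px|_] //=.
    by rewrite -px ap.
  by rewrite -px ap /=; lia.
have E2 : count_mem x (unzip2 flipped) =
    (nth false a x * count_mem x (unzip2 (pairings b)))%N.
  case/andP: fl => + _; rewrite /flipped.
  elim: (pairings b) => [|p s IHs] /=; first by rewrite muln0.
  case/andP => ap /IHs {}IHs.
  case ap1: (nth false a p.1) ap => ap; rewrite /= IHs; case: eqVneq => [px|_] //=.
    by move: ap; rewrite -px; case: nth.
  by move: ap; rewrite -px; case: nth => //= _; lia.
have := count_endpoint (xb : (x < size b)%N).
rewrite !heightS ?szE // IHx ?(ltnW xb) //.
have up : (0 < count_mem x (unzip1 (pairings b)))%N -> nth false b x = true.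
  by rewrite -has_count has_pred1 => /mapP[p /pairings_matched/matched_up + ->].
have down : (0 < count_mem x (unzip2 (pairings b)))%N -> nth false b x = false.
  by rewrite -has_count has_pred1 => /mapP[p /pairings_matched/matched_down + ->].
have rest : (0 < count_mem x (unpaired b))%N -> nth false a x = nth false b x.
  rewrite -has_count has_pred1; case/andP: fl => _ /allP flr /flr.
  by move/eqP.
move: E E1 E2 up down rest; case: (nth _ a x); case: (nth _ b x) => /=; lia.
Qed.

(** A pairing that covers the opening point of [p] encloses [p], so it also covers
    [x]; and [p] itself covers [x] but not its opening point. *)
Lemma flipped_count_lt p x : p \in flipped -> covers x p ->
  (count (covers p.1) flipped < count (covers x) flipped)%N.
Proof.
move=> pS xp; have [mp _] := flippedP pS.
have le : (count (predU (covers p.1) (pred1 p)) flipped <= count (covers x) flipped)%N.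
  rewrite -(@eq_in_count _ (predI (mem flipped) (predU (covers p.1) (pred1 p))) _ _); last first.
    by move=> q qS; rewrite /= qS.
  apply: sub_count => q /= /andP[/flippedP[mq _] /orP[qp|/eqP -> //]].
  by have := matched_nested mq mp qp; move: qp xp; rewrite /covers; lia.
have := count_predUI (covers p.1) (pred1 p) flipped.
rewrite [count (predI _ _) _](@eq_count _ _ pred0) => [|q /=]; last first.
  by apply/negP => /andP[+ /eqP E]; rewrite E /covers ltnn.
rewrite count_pred0 addn0 => E; move: le; rewrite E; apply: leq_trans.
by rewrite -[X in (X < _)%N]addn0 ltn_add2l -has_count has_pred1.
Qed.

Lemma flipped_count_end p : p \in flipped ->
  count (covers p.2.+1) flipped = count (covers p.1) flipped.
Proof.
move=> pS; have [mp _] := flippedP pS; have [p12 _ _ _] := mp.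
apply: eq_in_count => -[k l] /flippedP[mq _]; rewrite /covers /=.
have := matched_nested mp mq; have := matched_nested mq mp; rewrite /= => nested1 nested2.
have k_eq : k = p.1 -> l = p.2 by move=> /(matched_inj1 mq mp) <-.
have l_eq : l = p.2 -> k = p.1 by move=> /(matched_inj2 mq mp) <-.
by apply/idP/idP; lia.
Qed.
End Flips.

Section Dist.
Variables N K : nat.
Implicit Types a b : lpath N K.

(** No position is an endpoint of two pairings, so the letters of [flip S b] can be
    read off independently at each of them. *)
Lemma in_flips_is_flip a b : in_flips a b -> is_flip a b.
Proof.
case=> S Ssub aE.
have nthE k : (k < N)%N -> nth false a k = if k \in unzip1 S then false else
    if k \in unzip2 S then true else nth false b k.
  move=> kN; rewrite aE /flip (nth_map 0%N) ?size_iota ?size_tuple //.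
  by rewrite nth_iota ?size_tuple.
have Sm p : p \in S -> matched b p by move/Ssub/pairings_matched.
have in1 p : matched b p -> (p.1 \in unzip1 S) = (p \in S).
  move=> mp; apply/mapP/idP => [[q qS E]|pS]; last by exists p.
  by rewrite (matched_inj1 mp (Sm q qS) E).
have in2 p : matched b p -> (p.2 \in unzip2 S) = (p \in S).
  move=> mp; apply/mapP/idP => [[q qS E]|pS]; last by exists p.
  by rewrite (matched_inj2 mp (Sm q qS) E).
have up1 k : k \in unzip1 S -> nth false b k = true.
  by case/mapP=> p /Sm/matched_up + ->.
have down2 k : k \in unzip2 S -> nth false b k = false.
  by case/mapP=> p /Sm/matched_down + ->.
apply/andP; split; apply/allP.
  move=> p /pairings_matched mp; have [p12] := mp; rewrite size_tuple => p2N _ _.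
  have -> : nth false a p.1 = (p \notin S).
    rewrite nthE ?(ltn_trans p12) // in1 //; case: ifP => // _.
    case: ifP => [/down2|_]; by rewrite (matched_up mp).
  have -> : nth false a p.2 = (p \in S).
    rewrite nthE // in2 //; case: ifP => [/up1|_]; first by rewrite (matched_down mp).
    by rewrite (matched_down mp); case: ifP.
  by case: (p \in S).
move=> k kU; have kN : (k < N)%N.
  have : k \in iota 0 (size b) by rewrite -(perm_mem (pairings_perm b)) !mem_cat kU !orbT.
  by rewrite mem_iota size_tuple.
rewrite nthE //; case: ifP => [/mapP[p /Ssub/unpairedN/(_ kU)[/eqP]]//|_].
by case: ifP => // /mapP[p /Ssub/unpairedN/(_ kU)[_ /eqP]].
Qed.

Lemma dist_is_flip a b : is_flip a b -> dist a b = size (flipped a b).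
Proof.
case/andP=> /allP flp /allP flr; rewrite /dist.
pose D k := nth false a k != nth false b k.
have -> : #|[set i : 'I_N | tnth a i != tnth b i]| = count D (iota 0 N).
  rewrite -val_enum_ord count_map -size_filter cardE; congr size.
  rewrite {1}/enum_mem -enumT; apply: eq_filter => i.
  by rewrite /= inE !(tnth_nth false).
have /seq.permP/(_ D) := pairings_perm b; rewrite size_tuple => <-.
rewrite !count_cat !count_map.
have flip_up p : p \in pairings b -> D p.1 = ~~ nth false a p.1.
  by move=> /pairings_matched/matched_up bp; rewrite /D bp; case: nth.
have flip_down p : p \in pairings b -> D p.2 = ~~ nth false a p.1.
  move=> pb; have := flp p pb; have := matched_down (pairings_matched pb).
  by rewrite /D => ->; do 2!case: nth.
rewrite (eq_in_count flip_up) (eq_in_count flip_down).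
rewrite [count D _](_ : _ = 0%N); last first.
  by apply/eqP; rewrite -leqn0 leqNgt -has_count; apply/hasPn => k /flr; rewrite /D negbK.
by rewrite addn0 addnn -muln2 mulnK // size_filter.
Qed.
End Dist.

(** * Boxes, levels and strips *)

Lemma height_parity w x : (x <= size w)%N ->
  exists2 c : nat, (c <= x)%N & height w x = x%:Z - c%:Z *+ 2.
Proof.
elim: x => [|x IHx] xw; first by exists 0%N; rewrite // height0.
have [c cx hE] := IHx (ltnW xw); exists (c + ~~ nth false w x)%N.
  by case: nth => /=; lia.
by rewrite heightS // hE; case: nth => /=; lia.
Qed.

(** The box of the column [x] that has [n] boxes between it and the path [w]. In
    the coordinates [(x, n)] the region below [w] is a family of initial
    segments. *)
Definition lbox (w : seq bool) (x n : nat) : box :=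
  (x%:Z, height w x - 1 - n%:Z *+ 2).

(** The part of the path [w] over the pairing [p], translated down to level [n]. *)
Definition strip (w : seq bool) (p : nat * nat) (n : nat) : {fset box} :=
  [fset lbox w x n | x in iota p.1.+1 (p.2 - p.1)]%fset.

Lemma lbox_inj w x n y m : lbox w x n = lbox w y m -> x = y /\ n = m.
Proof. by case=> -> E; split=> //; lia. Qed.

Lemma stripP w p n c :
  reflect (exists2 x, covers x p & c = lbox w x n) (c \in strip w p n).
Proof.
apply: (iffP (imfsetP _ _ _ _)) => [] [x /= xp ->]; exists x => //.
  by move: xp; rewrite mem_iota /covers; lia.
by rewrite mem_iota; move: xp; rewrite /covers; lia.
Qed.

Lemma lbox_strip w p n x m : (lbox w x m \in strip w p n) = covers x p && (m == n).
Proof.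
apply/stripP/andP => [[y yp /lbox_inj[-> ->]] //|[xp /eqP ->]].
by exists x.
Qed.

(** Between its opening and closing steps, a pairing surrounds a Dyck path. *)
Lemma strip_dyck w p n : matched w p -> is_dyck_strip (strip w p n).
Proof.
move=> mp; have [p12 p2w hE low] := mp.
exists (lbox w p.1.+1 n), (take (p.2 - p.1.+1) (drop p.1.+1 w)).
have sz : size (take (p.2 - p.1.+1) (drop p.1.+1 w)) = (p.2 - p.1.+1)%N.
  by rewrite size_takel // size_drop leq_sub2r // ltnW.
have hs k : (k <= p.2 - p.1.+1)%N ->
    height (take (p.2 - p.1.+1) (drop p.1.+1 w)) k =
    height w (p.1.+1 + k)%N - height w p.1.+1.
  elim: k => [|k IHk] kp; first by rewrite addn0 subrr height0.
  rewrite heightS ?sz // IHk ?(ltnW kp) // addnS (@heightS w (p.1.+1 + k)); last by lia.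
  by rewrite nth_take // nth_drop; ring.
have h1 : height w p.1.+1 = height w p.1 + 1.
  by rewrite heightS ?(ltn_trans p12) // (matched_up mp).
have h2 : height w p.2.+1 = height w p.2 - 1.
  by rewrite heightS // (matched_down mp).
split.
  rewrite /dyck_word sz; apply/andP; split.
    by rewrite hs // subnKC //; lia.
  apply/allP => k; rewrite mem_iota => kp; rewrite hs; last by lia.
  by have := low (p.1.+1 + k)%N; lia.
apply/fsetP => c; apply/stripP/imfsetP => [[x xp ->]|[k kp ->]].
  move: xp; rewrite /covers => xp; exists (x - p.1.+1)%N.
    by rewrite /= -[_ :: _]/(iota 0 (size _).+1) mem_iota sz; lia.
  by rewrite hs ?subnKC /lbox /=; [congr pair; lia | lia | lia].
move: kp; rewrite /= -[_ :: _]/(iota 0 (size _).+1) mem_iota sz => kp.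
exists (p.1.+1 + k)%N; first by rewrite /covers; lia.
by rewrite hs /lbox /=; [congr pair => /=; lia | lia].
Qed.

(** Just above, NW or NE of a box of a strip is a box of level [n - 1], unless the
    path [w] goes down to the left (or up to the right), which happens only inside
    the pairing and gives a box of the strip itself. The level [n - 1] is written
    through the height so that [n = 0] is included. *)
Lemma upper_box_strip (w : seq bool) (q : nat * nat) n (c c' : box) :
  matched w q -> c \in strip w q n -> c' \in upper_boxes c ->
  c' \in strip w q n \/ exists2 x, (q.1 <= x <= q.2.+1)%N &
    c' = (x%:Z, height w x - 1 - n%:Z *+ 2 + 2).
Proof.
move=> mq /stripP[x xq ->]; have q2 := matched_down mq; have q1 := matched_up mq.
have q2w : (q.2 < size w)%N by case: mq.
case: q mq xq q1 q2 q2w => i j mq; rewrite /covers /= => /andP[ix xj] wi wj jw.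
rewrite !inE => /or3P[] /eqP -> /=.
- by right; exists x; [rewrite (ltnW ix) leqW | congr pair; lia].
- case: x ix xj => // x ix xj; have xw : (x < size w)%N by apply: leq_trans jw; apply: leqW.
  have hE := heightS xw; case wx: (nth false w x) hE => hE.
    by right; exists x; [lia | rewrite hE /=; congr pair; clear; lia].
  left; apply/stripP; exists x.
    have : x <> i by move=> E; rewrite E wi in wx.
    by rewrite /covers /=; lia.
  by rewrite /lbox hE /=; congr pair; clear; lia.
have xw : (x < size w)%N by apply: leq_ltn_trans jw.
have hE := heightS xw; case wx: (nth false w x) hE => hE.
  left; apply/stripP; exists x.+1.
    have : x <> j by move=> E; rewrite E wj in wx.
    by rewrite /covers /=; lia.
  by rewrite /lbox hE /=; congr pair; clear; lia.
by right; exists x.+1; [lia | rewrite hE /=; congr pair; clear; lia].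
Qed.

Section Region.
Variables N K : nat.
Variables a b : lpath N K.

(** The number of boxes between the two paths in the column [x]. *)
Definition level (x : nat) : nat := (absz (height b x - height a x) %/ 2)%N.

Lemma mem_between c : (c \in boxes_between a b) = between a b c.
Proof.
have range : between a b c -> exists x y : nat,
    [/\ x \in iota 0 N.+1, y \in iota 0 (2 * N).+1 & c = (x%:Z, y%:Z - N%:Z)].
  case: c => x y /and5P[/= _ x0 xN ay yb].
  have xN' : (absz x <= N)%N by lia.
  have [|c cx hE] := @height_parity b (absz x); first by rewrite size_tuple.
  have [|c' cx' hE'] := @height_parity a (absz x); first by rewrite size_tuple.
  exists (absz x), (absz (y + N%:Z)).
  by rewrite -![_ :: _]/(iota 0 _.+1) !mem_iota; split; [lia | lia | congr pair; lia].
apply/imfsetP/idP => [[d /andP[_ bd] ->] //|bc].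
exists c => //; apply/andP; split; last exact: bc.
exact/allpairsPdep/range.
Qed.

Hypothesis le_ab : path_le a b.

Lemma levelE x : (x <= N)%N -> height b x = height a x + (level x)%:Z *+ 2.
Proof.
move=> xN; have/path_leP/(_ x xN) := le_ab; rewrite /level.
have [|c cx ->] := @height_parity b x; first by rewrite size_tuple.
have [|c' cx' ->] := @height_parity a x; first by rewrite size_tuple.
by lia.
Qed.

Lemma lbox_between x n : (x <= N)%N ->
  (lbox b x n \in boxes_between a b) = (0 < x < N)%N && (n < level x)%N.
Proof.
move=> xN; rewrite mem_between /between /= levelE //.
have [|c cx ->] := @height_parity a x; first by rewrite size_tuple.
apply/and5P/andP => [[_ x0 xN' h1 h2]|[/andP[x0 xN'] nl]]; first by lia.
by split; lia.
Qed.

Lemma between_lbox c : c \in boxes_between a b -> exists x n,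
  [/\ (0 < x < N)%N, (n < level x)%N & c = lbox b x n].
Proof.
move=> cB; have := cB; rewrite mem_between; case: c cB => x y cB /and5P[/= oxy x0 xN ay yb].
have xN' : (absz x <= N)%N by lia.
have cE : (x, y) = lbox b (absz x) (absz (height b (absz x) - 1 - y)%R %/ 2)%N.
  congr pair; first by lia.
  have [|c cx hE] := @height_parity b (absz x); first by rewrite size_tuple.
  by lia.
move: cB; rewrite cE lbox_between // => /andP[x0N nl].
by exists (absz x), (absz (height b (absz x) - 1 - y)%R %/ 2)%N.
Qed.

Lemma height_step k : (k < N)%N ->
  height b k.+1 = height b k + (if nth false b k then 1 else -1).
Proof. by move=> kN; rewrite heightS ?size_tuple. Qed.

Lemma level_step k : (k < N)%N ->
  (level k.+1 + nth false a k = level k + nth false b k)%N.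
Proof.
move=> kN; have := levelE kN; have := levelE (ltnW kN).
rewrite !heightS ?size_tuple //.
by case: (nth _ a k); case: (nth _ b k) => /=; lia.
Qed.

Lemma level0 : level 0 = 0%N.
Proof. by rewrite /level !height0. Qed.

Lemma levelN : level N = 0%N.
Proof.
have := levelE (leqnn N); have /eqP -> := wordP a; have /eqP -> := wordP b.
by lia.
Qed.
End Region.

(** * Configurations satisfying Rule II *)

(** In the half-plane of positive abscissas, a strip is the graph of a function on
    an interval of natural numbers, minimal at both ends. *)
Lemma dyck_strip_columns (D : {fset box}) :
  is_dyck_strip D -> (forall c : box, c \in D -> 0 < c.1) ->
  exists (l r : nat) (f : nat -> int),
    [/\ (l <= r)%N,
        forall c : box, c \in D <-> exists2 x, (l <= x <= r)%N & c = (x%:Z, f x),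
        f l = f r & forall x, (l <= x <= r)%N -> f l <= f x].
Proof.
case=> -[x0 y0] [s [/andP[/eqP s_end /allP s_pos] ->]] D_pos.
have mem c : reflect (exists2 k, (k <= size s)%N & c = (x0 + k%:Z, y0 + height s k))
    (c \in path_boxes (x0, y0) s).
  apply: (iffP (imfsetP _ _ _ _)) => -[k ks ->]; exists k => //.
    by move: ks; rewrite -[X in in_mem _ X]/(mem (iota 0 (size s).+1)) mem_iota.
  by rewrite -[X in in_mem _ X]/(mem (iota 0 (size s).+1)) mem_iota.
have x0_pos : 0 < x0.
  have := D_pos (x0, y0); apply; apply/mem; exists 0%N => //.
  by rewrite height0 !addr0.
exists (absz x0), (absz x0 + size s)%N, (fun x => y0 + height s (x - absz x0)).
split.
- exact: leq_addr.
- move=> c; split=> [/mem[k ks ->]|[x xs ->]].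
    exists (absz x0 + k)%N; first by lia.
    by rewrite addKn; congr pair; lia.
  by apply/mem; exists (x - absz x0)%N; [lia | congr pair; lia].
- by rewrite subnn addKn s_end height0.
move=> x xs; rewrite subnn height0 lerD2l; apply: s_pos.
by rewrite mem_iota; lia.
Qed.

Section RuleII.
Variables N K : nat.
Variables (a b : lpath N K) (DD : {fset {fset box}}).
Hypotheses (le_ab : path_le a b) (conf : confII a b DD).
Local Notation level := (level a b).

Lemma conf_sub (D : {fset box}) c : D \in DD -> c \in D -> c \in boxes_between a b.
Proof.
case: conf => -[<- _ _] _ DDD cD; apply/bigfcupP; exists D => //.
by rewrite DDD.
Qed.

Lemma conf_cover c : c \in boxes_between a b -> exists2 D : {fset box}, D \in DD & c \in D.
Proof.
case: conf => -[<- _ _] _ /bigfcupP[D /andP[DDD _] cD]; by exists D.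
Qed.

Lemma conf_disjoint (D D' : {fset box}) c : D \in DD -> D' \in DD -> c \in D -> c \in D' -> D = D'.
Proof.
case: conf => -[_ /trivIfsetP tr _] _ DDD DDD' cD cD'.
apply/eqP; apply: contraT => ne; have /fdisjointP/(_ c cD) := tr D D' DDD DDD' ne.
by rewrite cD'.
Qed.

(** A strip at constant level, with steps of [b] up before it and down after it, is
    the strip of a pairing of [b]: its minimality at both ends is that of the
    chord. *)
Lemma columns_strip l r (f : nat -> int) (D : {fset box}) n :
  (0 < l <= r)%N -> (r < N)%N ->
  (forall c : box, c \in D <-> exists2 x, (l <= x <= r)%N & c = (x%:Z, f x)) ->
  f l = f r -> (forall x, (l <= x <= r)%N -> f l <= f x) ->
  (forall x, (l <= x <= r)%N -> f x = height b x - 1 - n%:Z *+ 2) ->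
  nth false b l.-1 = true -> nth false b r = false ->
  matched b (l.-1, r) /\ D = strip b (l.-1, r) n.
Proof.
move=> lr rN memD f_end f_min fE b_l b_r.
have fl := fE l; have fr := fE r.
have hl : height b l = height b l.-1 + 1.
  by have := @height_step _ _ b l.-1; rewrite b_l prednK; lia.
have hr := height_step b rN; rewrite b_r in hr.
split.
  split=> /=; rewrite ?size_tuple //; try lia.
  by move=> k kr; have := f_min k; have := fE k; lia.
apply/fsetP => c; apply/idP/stripP => [/memD[x xr ->]|[x xr ->]].
  by exists x; [rewrite /covers /=; lia | rewrite fE].
move: xr; rewrite /covers /= => xr; apply/memD; exists x; first by lia.
by rewrite fE; [|lia].
Qed.

(** Rule II forces each strip [D] to be the strip of a pairing, and all the columns
    from the opening point to the closing point of the pairing, both included, to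
    have their box of level [n - 1] in one strip [D']. If [x] is at level [0], no
    strip can lie above [D], as Rule II would give a box above [b]; so [D] touches
    [b] along its whole length. Otherwise the strip [D'] above [D] at [x] has to
    contain all the upper neighbours of [D], and the induction hypothesis for [D']
    gives their levels. *)
Lemma rule_II_strip n x (D : {fset box}) : D \in DD -> lbox b x n \in D ->
  exists p, [/\ matched b p, D = strip b p n &
    (0 < n)%N -> exists2 D' : {fset box}, D' \in DD &
      forall y, (p.1 <= y <= p.2.+1)%N -> lbox b y n.-1 \in D'].
Proof.
elim/ltn_ind: n x D => n IHn x D DDD xD.
have [_ _ /(_ D DDD) Ddyck] : is_configuration a b DD by case: conf.
have D_pos c : c \in D -> 0 < c.1
  by move=> /(conf_sub DDD)/(between_lbox le_ab)[y [m [yN _ ->]]] /=; lia.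
have [l [r [f [lr memD f_end f_min]]]] := dyck_strip_columns Ddyck D_pos.
have colD y : (l <= y <= r)%N -> (y%:Z, f y) \in D
  by move=> yr; apply/memD; exists y.
have inD y (z : int) : (y%:Z, z) \in D -> (l <= y <= r)%N /\ z = f y
  by case/memD => y' y'r [-> ->].
have levD y : (l <= y <= r)%N -> exists m,
    [/\ (0 < y < N)%N, (m < level y)%N & f y = height b y - 1 - m%:Z *+ 2]
  by move=> /colD/(conf_sub DDD)/(between_lbox le_ab)[y' [m [yN mlev [-> ->]]]]; exists m.
have [xr fx] := inD _ _ xD.
have l0 : (0 < l)%N by have [|m []] := levD l; lia.
have rN : (r < N)%N by have [|m []] := levD r; lia.
have lE : l.-1%:Z = l%:Z - 1 by lia.
case: n IHn xD fx => [|n] IHn xD fx.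
  (* [(x, f x + 2)] lies outside the region, so Rule II is never triggered. *)
  have top c c' : c \in D -> c' \in upper_boxes c -> c' \notin D ->
      c' \notin boxes_between a b.
    move=> cD cc' c'D; apply/negP => /conf_cover[D' DDD' c'D'].
    have DD' : D != D' by apply: contraNneq c'D => ->.
    have [_ /(_ D D' DDD DDD' DD') rII] := conf.
    have : (x%:Z, f x + 2) \in boxes_between a b.
      have /orP[] : ((x%:Z, f x + 2) \in D) || ((x%:Z, f x + 2) \in D').
      - by apply: (rII _ (x%:Z, f x)); [exists c, c' | apply: colD | rewrite mem_head].
      - exact: conf_sub.
      - exact: conf_sub.
    by rewrite mem_between /between /= => /and5P[_ _ _ _]; lia.
  have f_top y : (l <= y <= r)%N -> f y = height b y - 1 - 0%:Z *+ 2.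
    move=> yr; have [[|m] [yN mlev fE]] := levD y yr; first by rewrite fE.
    have /negP[] : (y%:Z, f y + 2) \notin boxes_between a b.
      apply: (top (y%:Z, f y)); [exact: colD | exact: mem_head |].
      by apply/negP => /inD[_]; lia.
    have -> : (y%:Z, f y + 2) = lbox b y m by congr pair; lia.
    by rewrite lbox_between //; lia.
  (* If [b] went down to [l], the NW neighbour would be a box of level [0]. *)
  have b_l : nth false b l.-1 = true.
    apply/negPn/negP => /negPf b_l.
    have l1N : (l.-1 < N)%N by lia.
    have := level_step le_ab l1N; have := height_step b l1N; rewrite b_l prednK // => hE levE.
    have [|m [_ mlev fl]] := levD l; first by lia.
    have := f_top l; rewrite leqnn lr => /(_ isT) flE.
    have /negP[] : (l%:Z - 1, f l + 1) \notin boxes_between a b.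
      apply: (top (l%:Z, f l)); [by apply: colD; lia | by rewrite !inE eqxx orbT |].
      by rewrite -lE; apply/negP => /inD; lia.
    have -> : (l%:Z - 1, f l + 1) = lbox b l.-1 0 by congr pair; lia.
    rewrite lbox_between //; last by lia.
    case: l.-1 l1N levE => [|k]; rewrite ?level0; lia.
  have b_r : nth false b r = false.
    apply/negP => b_r.
    have := level_step le_ab rN; have := height_step b rN; rewrite b_r => hE levE.
    have [|m [_ mlev fr]] := levD r; first by lia.
    have := f_top r; rewrite leqnn lr => /(_ isT) frE.
    have /negP[] : (r%:Z + 1, f r + 1) \notin boxes_between a b.
      apply: (top (r%:Z, f r)); [by apply: colD; lia | by rewrite !inE eqxx !orbT |].
      by apply/negP; rewrite -[_ + 1]/((r + 1)%N%:Z) => /inD; lia.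
    have -> : (r%:Z + 1, f r + 1) = lbox b r.+1 0 by congr pair; lia.
    rewrite lbox_between //.
    have : r.+1 <> N by move=> E; move: levE; rewrite E levelN; lia.
    lia.
  have [|mp ->] := columns_strip _ rN memD f_end f_min f_top b_l b_r; first by lia.
  by exists (l.-1, r).
have [m [xN mlev fxE]] := levD x xr.
have lboxE : lbox b x n = (x%:Z, f x + 2) by congr pair; lia.
have [D' DDD' xD'] : exists2 D' : {fset box}, D' \in DD & lbox b x n \in D'.
  by apply: conf_cover; rewrite lbox_between //; lia.
have DD' : D != D'.
  by apply/eqP => E; move: xD'; rewrite -E lboxE => /inD[_]; lia.
have [p' [mp' D'E _]] := IHn n (ltnSn n) x D' DDD' xD'.
have [_ /(_ D D' DDD DDD' DD') rII] := conf.
have {}rII c c' : c \in D -> c' \in upper_boxes c -> c' \notin D -> c' \in D'.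
  move=> cD cc' /negPf c'D; rewrite -[_ \in D']/(false || _) -c'D; apply: rII cc' => //.
  by exists (x%:Z, f x), (lbox b x n); rewrite lboxE colD // -lboxE xD' lboxE mem_head.
have inD' y z : (y%:Z, z) \in D' -> z = height b y - 1 - n%:Z *+ 2.
  by rewrite D'E => /stripP[y' _ [-> ->]].
have f_next y : (l <= y <= r)%N -> (y%:Z, f y + 2) \in D'.
  move=> yr; apply: (rII (y%:Z, f y)); [exact: colD | exact: mem_head |].
  by apply/negP => /inD[_]; lia.
have f_left : (l.-1%:Z, f l + 1) \in D'.
  apply: (rII (l%:Z, f l)); [by apply: colD; lia | by rewrite lE !inE eqxx orbT |].
  by apply/negP => /inD; lia.
have f_right : (r.+1%:Z, f r + 1) \in D'.
  apply: (rII (r%:Z, f r)); [by apply: colD; lia | |].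
    by rewrite (_ : r.+1%:Z = r%:Z + 1) ?inE ?eqxx ?orbT //; lia.
  by apply/negP => /inD; lia.
clear rII IHn mp' D'E levD inD.
have f_level y : (l <= y <= r)%N -> f y = height b y - 1 - n.+1%:Z *+ 2.
  by move=> /f_next/inD'; lia.
have b_l : nth false b l.-1 = true.
  have l1N : (l.-1 < N)%N by lia.
  have := height_step b l1N; have := inD' _ _ f_left; have := f_level l.
  by rewrite prednK //; case: nth; lia.
have b_r : nth false b r = false.
  have := height_step b rN; have := inD' _ _ f_right; have := f_level r.
  by case: nth; lia.
have [|mp ->] := columns_strip _ rN memD f_end f_min f_level b_l b_r; first by lia.
exists (l.-1, r); split=> // _; exists D' => //= y yr.
have [yl|ly] := ltnP y l.
  have -> : y = l.-1 by lia.
  by rewrite /lbox -(inD' _ _ f_left).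
have [yr'|ry] := ltnP r y.
  have -> : y = r.+1 by lia.
  by rewrite /lbox -(inD' _ _ f_right).
by rewrite /lbox -(inD' _ _ (f_next y _)) ?f_next //; lia.
Qed.

End RuleII.

(** The candidate configuration: one strip per flipped pairing, at the level given
    by the number of boxes in the column of its opening point. These boxes belong
    to the strips of the enclosing flipped pairings, one for each. *)
Definition flip_configuration N K (a b : lpath N K) : {fset {fset box}} :=
  [fset strip b p (level a b p.1) | p in flipped a b]%fset.

Section RuleIICanonical.
Variables N K : nat.
Variables (a b : lpath N K) (DD : {fset {fset box}}).
Hypotheses (le_ab : path_le a b) (conf : confII a b DD).
Local Notation level := (level a b).

Lemma conf_strip x n : (0 < x < N)%N -> (n < level x)%N ->
  exists p, [/\ matched b p, strip b p n \in DD & covers x p].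
Proof.
move=> xN nlev; have [|D DDD xD] := conf_cover conf (c := lbox b x n).
  by rewrite lbox_between //; lia.
have [p [mp DE _]] := rule_II_strip le_ab conf DDD xD.
exists p; rewrite -DE; split=> //.
by move: xD; rewrite DE lbox_strip => /andP[].
Qed.

Lemma conf_strip_unique p q n x : strip b p n \in DD -> strip b q n \in DD ->
  covers x p -> covers x q -> covers^~ p =1 covers^~ q.
Proof.
move=> pD qD xp xq y.
have pE m : covers m p = (lbox b m n \in strip b p n) by rewrite lbox_strip eqxx andbT.
have qE m : covers m q = (lbox b m n \in strip b q n) by rewrite lbox_strip eqxx andbT.
rewrite pE qE; congr (_ \in _).
by apply: (conf_disjoint conf (c := lbox b x n)); rewrite -?pE -?qE.
Qed.

(** By [rule_II_strip] the strip over [p] contains a box of level [n - 1] in the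
    columns of both endpoints. A box of level [n] there would belong to a strip
    that also covers a column of [p], since the endpoints of distinct pairings
    differ, and so would meet the strip of [p] at the same level. *)
Lemma conf_strip_level p n : matched b p -> strip b p n \in DD ->
  [/\ level p.1 = n, level p.2.+1 = n, (n < level p.1.+1)%N & (n < level p.2)%N].
Proof.
move=> mp pD; have [p12] := mp; rewrite size_tuple => p2N _ _.
have inside x : covers x p -> (n < level x)%N.
  rewrite /covers => xp; have : lbox b x n \in boxes_between a b.
    by apply: (conf_sub conf pD); rewrite lbox_strip eqxx andbT.
  by rewrite lbox_between; lia.
have above y : (p.1 <= y <= p.2.+1)%N -> (n <= level y)%N.
  case: n pD inside => // n pD _ yp.
  have [|q [mq E /(_ isT)[D' DDD' D'D]]] := @rule_II_strip _ _ _ _ _ le_ab conf n.+1 p.2 _ pD.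
    by rewrite lbox_strip eqxx andbT /covers; lia.
  have pq x : covers x p = covers x q.
    by have := congr1 (fun D : {fset box} => lbox b x n.+1 \in D) E; rewrite !lbox_strip eqxx !andbT.
  have : lbox b y n \in boxes_between a b.
    apply: (conf_sub conf DDD'); apply: D'D; have [q12 _ _ _] := mq.
    by have := pq p.1.+1; have := pq p.2; have := pq p.1; have := pq p.2.+1; rewrite /covers; lia.
  by rewrite lbox_between; lia.
split; try by apply: inside; rewrite /covers; lia.
  apply/eqP; rewrite eqn_leq above ?andbT; last by lia.
  rewrite leqNgt; apply/negP => nlev.
  have p1 : (0 < p.1 < N)%N by case: p.1 nlev p12 => [|k]; rewrite ?level0; lia.
  have [q [mq qD p1q]] := conf_strip p1 nlev.
  have q2 : q.2 <> p.1 by move=> E; have := matched_up mp; rewrite -E (matched_down mq).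
  have := conf_strip_unique qD pD (x := p.1.+1); move: p1q; rewrite /covers => p1q.
  by move=> /(_ _ _ p.1); lia.
apply/eqP; rewrite eqn_leq above ?andbT; last by lia.
rewrite leqNgt; apply/negP => nlev.
have p2 : (0 < p.2.+1 < N)%N.
  suff : p.2.+1 <> N by lia.
  by move=> E; move: nlev; rewrite E levelN.
have [q [mq qD p2q]] := conf_strip p2 nlev.
have q1 : q.1 <> p.2 by move=> E; have := matched_down mp; rewrite -E (matched_up mq).
have := conf_strip_unique qD pD (x := p.2); move: p2q; rewrite /covers => p2q.
by move=> /(_ _ _ p.2.+1); lia.
Qed.

Lemma conf_strip_flipped p n : matched b p -> strip b p n \in DD ->
  nth false a p.1 = false /\ nth false a p.2 = true.
Proof.
move=> mp pD; have [l1 l2 l3 l4] := conf_strip_level mp pD.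
have [p12] := mp; rewrite size_tuple => p2N _ _.
have := level_step le_ab (ltn_trans p12 p2N); have := level_step le_ab p2N.
by rewrite (matched_up mp) (matched_down mp); do 2!case: nth => /=; lia.
Qed.

(** At a step where the paths differ, the number of boxes in the column changes by
    one. The strip of the extra box stops there, so [k] is an endpoint of its
    pairing. *)
Lemma conf_diff k : (k < N)%N -> nth false a k != nth false b k ->
  exists p, [/\ matched b p, strip b p (level p.1) \in DD & (k == p.1) || (k == p.2)].
Proof.
move=> kN; have := level_step le_ab kN.
case ak: (nth false a k); case bk: (nth false b k) => //= levE _.
  have [||p [mp pD pk]] := @conf_strip k (level k.+1).
  - by case: k kN levE {ak bk} => [|k]; rewrite ?level0; lia.
  - by lia.
  have [E1 E2 _ _] := conf_strip_level mp pD.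
  exists p; rewrite E1; split=> //; apply/orP; right; apply/eqP.
  move: pk; rewrite /covers => /andP[pk1 pk2].
  apply/eqP; apply: contraT => kp.
  have : lbox b k.+1 (level k.+1) \in boxes_between a b.
    by apply: (conf_sub conf pD); rewrite lbox_strip eqxx andbT /covers; lia.
  by rewrite lbox_between; lia.
have [||p [mp pD pk]] := @conf_strip k.+1 (level k).
- suff : k.+1 <> N by lia.
  by move=> E; move: levE; rewrite E levelN //; lia.
- by lia.
have [E1 E2 _ _] := conf_strip_level mp pD.
exists p; rewrite E1; split=> //; apply/orP; left.
move: pk; rewrite /covers => /andP[pk1 pk2].
apply: contraT => kp.
have : lbox b k (level k) \in boxes_between a b.
  by apply: (conf_sub conf pD); rewrite lbox_strip eqxx andbT /covers; lia.
by rewrite lbox_between; lia.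
Qed.

(** The steps where the paths differ are exactly the endpoints of the pairings that
    carry a strip; so both letters of a pairing change or none does, and unpaired
    letters do not change. *)
Lemma conf_is_flip : is_flip a b.
Proof.
apply/andP; split; apply/allP; last first.
  move=> k kU; have kN : (k < N)%N.
    have : k \in iota 0 (size b) by rewrite -(perm_mem (pairings_perm b)) !mem_cat kU !orbT.
    by rewrite mem_iota size_tuple.
  apply: contraT => /(conf_diff kN)[p [/matched_pairings/unpairedN/(_ kU)[/negPf -> /negPf ->]]].
  by [].
move=> p /pairings_matched mp; have [p12] := mp; rewrite size_tuple => p2N _ _.
have bu := matched_up mp; have bd := matched_down mp.
have both k : (k < N)%N -> (k == p.1) || (k == p.2) ->
    nth false a k != nth false b k -> nth false a p.1 != nth false a p.2.
  move=> kN kp /(conf_diff kN)[q [mq qD kq]].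
  suff E : q = p by have [] := conf_strip_flipped mq qD; rewrite E => -> ->.
  case/orP: kq kp => /eqP -> /orP[] /eqP E.
  - exact: (matched_inj1 mq mp E).
  - by move: bd; rewrite -E (matched_up mq).
  - by move: bu; rewrite -E (matched_down mq).
  - exact: (matched_inj2 mq mp E).
have := both p.1; have := both p.2; rewrite !eqxx orbT bu bd p2N (ltn_trans p12) //.
by case: (nth _ a p.1); case: (nth _ a p.2) => //= h1 h2; [apply: h1 | apply: h2].
Qed.

(** Each strip is that of a pairing changed at its opening letter, at the level
    prescribed by [conf_strip_level]; conversely the opening letter of a flipped
    pairing is a step where the paths differ, so the pairing carries a strip. *)
Lemma conf_unique : DD = flip_configuration a b.
Proof.
apply/fsetP => D; apply/idP/imfsetP => [DDD|[p /= pS ->]].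
  have [c cD] : exists c, c \in D.
    case: conf => -[_ _ /(_ D DDD)[[x y] [s [_ ->]]]] _.
    by exists (x + 0%N%:Z, y + height s 0); apply/imfsetP; exists 0%N => //=; rewrite mem_head.
  have [x [n [xN nlev cE]]] := between_lbox le_ab (conf_sub conf DDD cD).
  rewrite cE in cD; have [p [mp DE _]] := rule_II_strip le_ab conf DDD cD.
  have pD : strip b p n \in DD by rewrite -DE.
  exists p => /=; last by have [-> _ _ _] := conf_strip_level mp pD.
  by rewrite mem_filter matched_pairings // (conf_strip_flipped mp pD).1.
have [mp ap] := flippedP pS; have [p12] := mp; rewrite size_tuple => p2N _ _.
have p1N := ltn_trans p12 p2N.
have [||q [mq qD qk]] := @conf_diff p.1; rewrite ?ap ?(matched_up mp) //.
suff <- : q = p by [].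
case/orP: qk => /eqP E; first exact: (matched_inj1 mq mp (esym E)).
by have := matched_up mp; rewrite E (matched_down mq).
Qed.
End RuleIICanonical.

(** * The configuration of a flip *)

Section Existence.
Variables N K : nat.
Variables (a b : lpath N K).
Hypothesis fl : is_flip a b.
Local Notation level := (level a b).
Implicit Types (p q : nat * nat) (c d : box) (D : {fset box}).

Let size_paths : size a = size b. Proof. by rewrite !size_tuple. Qed.

Lemma is_flip_le : path_le a b.
Proof.
apply/path_leP => x xN.
by have := is_flip_height size_paths fl (x := x); rewrite size_tuple => ->; lia.
Qed.

Lemma level_count x : (x <= N)%N -> level x = count (covers x) (flipped a b).
Proof.
move=> xN; have := levelE is_flip_le xN.
by have := is_flip_height size_paths fl (x := x); rewrite size_tuple => -> //; lia.
Qed.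

Lemma flipped_level_lt p x : p \in flipped a b -> covers x p ->
  (level p.1 < level x)%N.
Proof.
move=> pS xp; have [mp _] := flippedP pS; have [p12] := mp.
rewrite size_tuple => p2N _ _; move: (xp); rewrite /covers => xp'.
by rewrite !level_count; [exact: (flipped_count_lt size_paths) | lia | lia].
Qed.

Lemma flipped_level_end p : p \in flipped a b -> level p.2.+1 = level p.1.
Proof.
move=> pS; have [mp _] := flippedP pS; have [p12] := mp.
rewrite size_tuple => p2N _ _.
by rewrite !level_count; [exact: (flipped_count_end size_paths) | lia | lia].
Qed.

(** Two pairings over a common column are nested, and the level strictly increases
    from the outer to the inner one. *)
Lemma flipped_strip_inj p q x : p \in flipped a b -> q \in flipped a b ->
  covers x p -> covers x q -> level p.1 = level q.1 -> p = q.
Proof.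
move=> pS qS xp xq levE; have [mp _] := flippedP pS; have [mq _] := flippedP qS.
apply: matched_inj1 mp mq _; move: xp xq; rewrite /covers => xp xq.
case: (ltngtP p.1 q.1) => // lt.
  by have := @flipped_level_lt p q.1 pS; rewrite /covers; lia.
by have := @flipped_level_lt q p.1 qS; rewrite /covers; lia.
Qed.

(** Discrete intermediate values: take the last [k] before [x] where the number of
    boxes is at most [n]. It increases there from [n] to [n + 1], so [k] is the
    opening letter of a flipped pairing, and this pairing is not closed before
    [x], as the number of boxes would be [n] again. *)
Lemma level_flipped x n : (x <= N)%N -> (n < level x)%N ->
  exists p, [/\ p \in flipped a b, covers x p & level p.1 = n].
Proof.
move=> xN nlev.
have [k [kx klev kmax]] : exists k, [/\ (k < x)%N, (level k <= n)%N &
    forall y, (k < y <= x)%N -> (n < level y)%N].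
  elim: x xN nlev => [|x IHx] xN nlev; first by rewrite level0 in nlev.
  have [lex|ltx] := leqP (level x) n.
    by exists x; split=> // y yx; have -> : y = x.+1 by lia.
  have [k [kx klev kmax]] := IHx (ltnW xN) ltx; exists k; split=> //; first by lia.
  move=> y; have [->//|yx] := eqVneq y x.+1; by move=> ky; apply: kmax; lia.
have kN : (k < N)%N by lia.
have := level_step is_flip_le kN; have := kmax k.+1.
rewrite ltnSn kx => /(_ isT) kS.
case ak: (nth false a k); case bk: (nth false b k) => /= levE; try lia.
have : k \in iota 0 (size b) by rewrite mem_iota size_tuple.
rewrite -(perm_mem (pairings_perm b)) !mem_cat => /or3P[].
- case/mapP => -[i j] ijb /= ki; subst i; exists (k, j).
  have ijS : (k, j) \in flipped a b by rewrite mem_filter ijb /= ak.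
  split=> //=; last by lia.
  rewrite /covers /= kx leqNgt; apply/negP => jx.
  have [[/= kj _ _ _] _] := flippedP ijS.
  by have := kmax j.+1; have /= := flipped_level_end ijS; lia.
- by case/mapP => p /pairings_matched/matched_down + kp; rewrite -kp bk.
by case/andP: fl => _ /allP flr /flr; rewrite ak bk.
Qed.

Lemma flip_configurationP (D : {fset box}) :
  reflect (exists2 p : nat * nat, p \in flipped a b & D = strip b p (level p.1))
          (D \in flip_configuration a b).
Proof. exact: imfsetP. Qed.

Lemma flip_strips_disjoint (D D' : {fset box}) c : D \in flip_configuration a b ->
  D' \in flip_configuration a b -> c \in D -> c \in D' -> D = D'.
Proof.
move=> /flip_configurationP[p pS ->] /flip_configurationP[q qS ->] /stripP[x xp ->].
rewrite lbox_strip => /andP[xq /eqP E].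
by rewrite (flipped_strip_inj pS qS xp xq E).
Qed.

Lemma flip_is_configuration : is_configuration a b (flip_configuration a b).
Proof.
have le_ab := is_flip_le; split.
- apply/fsetP => c; apply/bigfcupP/idP => [[D /andP[/flip_configurationP[p pS ->] _]]|].
    case/stripP => x xp ->; have [[p12] ] := flippedP pS.
    rewrite size_tuple => p2N _ _ _; have := flipped_level_lt pS xp.
    by move: xp; rewrite /covers => xp; rewrite lbox_between //; lia.
  move=> /(between_lbox le_ab)[x [n [xN nlev ->]]].
  have [|p [pS xp pn]] := level_flipped _ nlev; first by lia.
  exists (strip b p n); last by rewrite lbox_strip xp eqxx.
  by rewrite andbT; apply/flip_configurationP; exists p; rewrite ?pn.
- apply/trivIfsetP => D D' DD DD' ne; apply/fdisjointP => c cD.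
  by apply: contraNN ne => cD'; apply/eqP/(flip_strips_disjoint DD DD' cD cD').
by move=> D /flip_configurationP[p /flippedP[mp _] ->]; apply: strip_dyck.
Qed.

(** If some box of [D'] is just above, NW or NE of a box of [D], then it is one
    level higher, so the pairing [p] of [D'] meets the closed range of the pairing
    [q] of [D]. Endpoints being distinct, [p] encloses [q] with its strip one level
    above, hence contains all the upper neighbours of [D] that are not in [D]. *)
Lemma flip_confII : confII a b (flip_configuration a b).
Proof.
split; first exact: flip_is_configuration.
move=> D D' /flip_configurationP[q qS DE] /flip_configurationP[p pS D'E] DD' [c [c' [cD c'D' cc']]].
have [mq aq] := flippedP qS; have [mp ap] := flippedP pS.
have [q12] := mq; have [p12] := mp; rewrite !size_tuple => p2N _ _ q2N _ _.
move nE: (level q.1) DE => n DE.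
have upper d d' : d \in D -> d' \in upper_boxes d -> d' \in D \/
    exists2 x, (q.1 <= x <= q.2.+1)%N &
      d' = (x%:Z, height b x - 1 - n%:Z *+ 2 + 2).
  by rewrite DE; apply: upper_box_strip.
have [c'D|[x xq c'E]] := upper c c' cD cc'.
  have DDc : D \in flip_configuration a b by rewrite DE -nE; apply/flip_configurationP; exists q.
  have DDc' : D' \in flip_configuration a b by apply/flip_configurationP; exists p.
  by case/eqP: DD'; exact: flip_strips_disjoint DDc DDc' c'D c'D'.
have [xp pn] : covers x p /\ n = (level p.1).+1.
  by move: c'D'; rewrite c'E D'E => /stripP[y yp [] -> E]; split; [|move: E; clear; lia].
have encl : (p.1 < q.1 /\ q.2 < p.2)%N.
  have p2q1 : p.2 <> q.1 by move=> E; have := matched_up mq; rewrite -E (matched_down mp).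
  have p1q2 : p.1 <> q.2 by move=> E; have := matched_down mq; rewrite -E (matched_up mp).
  have pq1 : p.1 <> q.1 by move=> E; move: pn; rewrite -nE -E => /n_Sn.
  have p_high : ~~ covers p.1 q.
    by apply/negP => /(flipped_level_lt qS); rewrite nE pn ltnNge leqnSn.
  have pq := matched_nested mp mq; have qp := matched_nested mq mp.
  by move: xp p_high; rewrite /covers; clear -p2q1 p1q2 pq1 pq qp xq q12 p12; lia.
move=> d d' dD dd'; have [->//|[y yq ->]] := upper d d' dD dd'.
apply/orP; right; rewrite D'E; apply/stripP; exists y.
  by case: encl; rewrite /covers; clear -yq; lia.
by rewrite pn; congr pair; clear; lia.
Qed.

Lemma card_flip_configuration : #|` flip_configuration a b| = size (flipped a b).
Proof.
rewrite /flip_configuration card_in_imfset => [|[i j] [k l] /= pS qS E].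
  by rewrite /= undup_id // filter_uniq // pairings_uniq.
have [[/= ij _ _ _] _] := flippedP pS.
have : lbox b j (level i) \in strip b (k, l) (level k).
  by rewrite -E lbox_strip eqxx andbT /covers /= ij leqnn.
rewrite lbox_strip => /andP[jq /eqP levE].
by apply: flipped_strip_inj pS qS _ jq levE; rewrite /covers /= ij leqnn.
Qed.
End Existence.

(** * The two sides agree *)

Section Generating.
Variables N K : nat.
Variables (a b : lpath N K).

Lemma QII_cup_poly : QII a b = cup_poly [::] a b.
Proof.
have szE : size a = size b by rewrite !size_tuple.
rewrite /QII; case: eqVneq => [->|ab]; first by rewrite cup_poly_diag.
rewrite cup_polyE //; case: ifP => le_ab; last first.
  by case: ifP => // fl; rewrite is_flip_le in le_ab.
case: ifP => fl; last first.
  rewrite big1 // => DD /asboolP conf.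
  by rewrite (conf_is_flip le_ab conf) in fl.
have [conf _] := flip_confII fl; have [cov _ _] := conf.
rewrite big_mkcond (bigD1_seq (flip_configuration a b)) ?fset_uniq //=; last first.
  rewrite fpowersetE; apply/fsubsetP => D DDD; rewrite fpowersetE -cov.
  by apply/fsubsetP => c cD; apply/bigfcupP; exists D; rewrite ?DDD.
rewrite asboolT; last exact: flip_confII.
rewrite card_flip_configuration // big1 ?addr0 // => DD neDD.
by case: ifP => // /asboolP confDD; rewrite (conf_unique le_ab confDD) eqxx in neDD.
Qed.
End Generating.

Theorem theorem5 (N K : nat) (hN : (1 <= N)%N) (hK : (K <= N)%N)
  (bar : pmod laurent N K -> pmod laurent N K) (hbar : is_bar_involution bar)
  (C : lpath N K -> pmod laurent N K) (P : lpath N K -> lpath N K -> {poly int})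
  (hCP : is_KL_basis bar C P) (alpha beta : lpath N K) :
  evalz tinv (P alpha beta) = evalz tinv (QII alpha beta) /\
  (in_flips alpha beta ->
   evalz tinv (P alpha beta) = tinv ^+ dist alpha beta).
Proof.
rewrite (KL_cup_poly hbar hCP) QII_cup_poly; split=> // /in_flips_is_flip fl.
by rewrite cup_polyE ?size_tuple // fl evalzXn dist_is_flip.
Qed.
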